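(* Let $G$ be a matching covered, Pfaffian, bipartite graph. Then $G$ is cycle-conformal if and only if $G$ can be constructed (up to isomorphism) from the cycle $C_4$ of length $4$ by a (possibly empty) finite sequence of bisubdivisions and 3-path operations.
   Context: Graphs are finite, without loops or multiple edges. A graph is matching covered if it is connected, has at least four vertices, and each of its edges is contained in a perfect matching of it. A cycle $C \subseteq G$ is conformal if $G - V(C)$ has a perfect matching (the empty graph counts as having one). A graph is cycle-conformal if it has a perfect matching and all of its even cycles are conformal. A graph with a perfect matching is Pfaffian if there exists an orientation of its edges such that each conformal, even cycle has an odd number of edges oriented in the same direction in either direction of traversal. Let $H$ be a graph and $e = uv \in E(H)$. A bisubdivision of $H$ at $e$ is a graph obtained from $H$ by subdividing the edge $e$ with an even number of subdivision vertices (i.e. replacing $e$ by a $u$-$v$-path of odd length whose internal vertices are new). A graph $H'$ is constructed from $H$ via the 3-path operation at $e$ if $H'$ is obtained from $H$ by adding two new vertices $x_1, x_2 \notin V(H)$ and the edges $ux_1, x_1x_2, x_2v$ (the edge $e$ is kept). *)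

(* Defs.v *)
From mathcomp Require Import all_boot.

Set Implicit Arguments.
Unset Strict Implicit.
Unset Printing Implicit Defensive.

Record sgraph := SGraph {
  svertex :> finType;
  sedge : rel svertex;
  sedge_sym : symmetric sedge;
  sedge_irrefl : irreflexive sedge }.

Arguments sedge {s} x y.

Definition isomorphic (G H : sgraph) : Prop :=
  exists2 f : G -> H, bijective f & {mono f : x y / sedge x y}.

Definition connected (G : sgraph) : Prop :=
  forall x y : G, connect sedge x y.

Definition bipartite (G : sgraph) : Prop :=
  exists A : {set G}, forall x y : G, sedge x y -> (x \in A) != (y \in A).

Definition edges (G : sgraph) : {set {set G}} :=
  [set [set p.1; p.2] | p : G * G & sedge p.1 p.2].

(* [M] is a perfect matching of the subgraph of [G] induced by [A]: pairwise
   disjoint edges of [G] whose union is exactly [A].  For [A = set0] the empty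
   matching qualifies. *)
Definition perfect_matching_of (G : sgraph) (A : {set G}) (M : {set {set G}}) :=
  (M \subset edges G) && partition M A.

Definition has_perfect_matching (G : sgraph) (A : {set G}) : Prop :=
  exists M, perfect_matching_of A M.

Definition matching_covered (G : sgraph) : Prop :=
  [/\ connected G, 4 <= #|G| &
      forall e, e \in edges G ->
        exists2 M, perfect_matching_of [set: G] M & e \in M].

(* A cycle is listed by its vertices in the order of one of its traversals;
   every starting point and both directions give valid lists. *)
Definition is_cycle (G : sgraph) (c : seq G) : bool :=
  (2 < size c) && ucycleb sedge c.

Definition even_cycle (G : sgraph) (c : seq G) : bool :=
  is_cycle c && ~~ odd (size c).

Definition conformal (G : sgraph) (c : seq G) : Prop :=
  has_perfect_matching (~: [set x in c]).

Definition cycle_conformal (G : sgraph) : Prop :=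
  has_perfect_matching [set: G] /\
  forall c : seq G, even_cycle c -> conformal c.

(* [D x y] means that the edge xy is oriented from x to y. *)
Definition orientation (G : sgraph) (D : rel G) : Prop :=
  (forall x y : G, D x y -> sedge x y) /\
  (forall x y : G, sedge x y -> D x y = ~~ D y x).

Definition pfaffian (G : sgraph) : Prop :=
  has_perfect_matching [set: G] /\
  exists2 D : rel G, orientation D &
    forall c : seq G, even_cycle c -> conformal c ->
      odd (count (fun x => D x (next c x)) c).

Definition path_edge (T : eqType) (s : seq T) : rel T :=
  fun x y => infix [:: x; y] s || infix [:: y; x] s.

(* The u-v-path with [n] new internal vertices. *)
Definition new_path (T : finType) (u v : T) (n : nat) : seq (T + 'I_n) :=
  inl u :: rcons [seq inr i | i <- enum 'I_n] (inl v).

Lemma path_edge_sym (T : eqType) (s : seq T) : symmetric (path_edge s).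
Proof. by move=> x y; rewrite /path_edge orbC. Qed.

Lemma path_edge_irrefl (T : eqType) (s : seq T) :
  uniq s -> irreflexive (path_edge s).
Proof.
move=> us x; rewrite /path_edge orbb; apply/negP=> /infix_uniq/(_ us).
by rewrite /= inE eqxx.
Qed.

Lemma new_path_uniq (T : finType) (u v : T) n : u != v -> uniq (new_path u v n).
Proof.
move=> uv; rewrite /= mem_rcons inE rcons_uniq map_inj_uniq ?enum_uniq; last first.
  by move=> i j [].
by rewrite andbT negb_or uv; apply/andP; split; apply/mapP=> -[].
Qed.

Lemma sedge_neq (G : sgraph) (u v : G) : sedge u v -> u != v.
Proof. by apply: contraTneq => ->; rewrite sedge_irrefl. Qed.

Section Ear.
Variables (G : sgraph) (u v : G) (n : nat).

Definition old_edge (x y : G + 'I_n) : bool :=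
  match x, y with inl a, inl b => sedge a b | _, _ => false end.

Definition add_path_rel : rel (G + 'I_n) :=
  fun x y => old_edge x y || path_edge (new_path u v n) x y.

(* The edge uv is deleted before the path is added; for [n = 0] the path
   consists of the edge uv itself and the graph is unchanged. *)
Definition subdivide_rel : rel (G + 'I_n) :=
  fun x y => (old_edge x y && ([set x; y] != [set inl u; inl v]))
             || path_edge (new_path u v n) x y.

Lemma old_edge_sym : symmetric old_edge.
Proof. by move=> [a|i] [b|j] //=; rewrite sedge_sym. Qed.

Lemma old_edge_irrefl : irreflexive old_edge.
Proof. by move=> [a|i] //=; rewrite sedge_irrefl. Qed.

Lemma add_path_sym : symmetric add_path_rel.
Proof. by move=> x y; rewrite /add_path_rel old_edge_sym path_edge_sym. Qed.

Lemma subdivide_sym : symmetric subdivide_rel.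
Proof.
by move=> x y; rewrite /subdivide_rel old_edge_sym path_edge_sym [[set x; y]]setUC.
Qed.

Hypothesis uv : sedge u v.

Lemma add_path_irrefl : irreflexive add_path_rel.
Proof.
move=> x; rewrite /add_path_rel old_edge_irrefl path_edge_irrefl //.
exact/new_path_uniq/sedge_neq.
Qed.

Lemma subdivide_irrefl : irreflexive subdivide_rel.
Proof.
move=> x; rewrite /subdivide_rel old_edge_irrefl path_edge_irrefl //.
exact/new_path_uniq/sedge_neq.
Qed.

Definition add_path : sgraph := SGraph add_path_sym add_path_irrefl.
Definition subdivide : sgraph := SGraph subdivide_sym subdivide_irrefl.

End Ear.

Definition bisubdivision (G : sgraph) (u v : G) (k : nat) (uv : sedge u v) :
  sgraph := subdivide k.*2 uv.

Definition three_path (G : sgraph) (u v : G) (uv : sedge u v) : sgraph :=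
  add_path 2 uv.

Definition C4_rel : rel 'I_4 := fun i j => (ordS i == j) || (ordS j == i).

Lemma C4_sym : symmetric C4_rel.
Proof. by move=> i j; rewrite /C4_rel orbC. Qed.

Lemma C4_irrefl : irreflexive C4_rel.
Proof. by case=> [[|[|[|[|]]]]]. Qed.

Definition C4 : sgraph := SGraph C4_sym C4_irrefl.

Inductive C4_constructible : sgraph -> Prop :=
| constr_C4 : C4_constructible C4
| constr_bisubdivision (H : sgraph) (u v : H) (k : nat) (uv : sedge u v) :
    C4_constructible H -> C4_constructible (bisubdivision k uv)
| constr_three_path (H : sgraph) (u v : H) (uv : sedge u v) :
    C4_constructible H -> C4_constructible (three_path uv).

(* Main.v *)
Require Import Defs.
From mathcomp Require Import all_boot zify.

(** Let G be bipartite and matching covered with a Pfaffian orientation.  If G is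
    cycle-conformal, then every cycle of G is an even conformal cycle, so the
    orientation makes every cycle odd: each of them has an odd number of forward
    edges.  This is a strong restriction.  Apply it to the three cycles of a theta,
    that is, of three internally disjoint paths with common ends: every path is
    run through once in each direction, and adding up the three parities shows
    that the paths have odd length.  So the two branch vertices of a theta lie in
    different colour classes ([theta_col]).  Consequently G has no subdivision of
    K4, because two of its four branch vertices would have the same colour while
    any two of them are the branch vertices of a theta.

    G is also 2-connected ([matching_covered_two_connected]).  Without a theta it is
    a cycle.  Otherwise take a theta whose first two paths s and t form a longest
    possible cycle and in which s is as short as possible for that length.  The path
    s has an interior, or exchanging it with the third path would give a longer
    cycle.  An interior vertex of s with a third edge starts an ear of the cycle,
    which either yields a theta with a shorter path s, or crosses the third path;
    the colours of the thetas that arise exclude the latter ([no_crossing]).  So all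
    interior vertices of s have degree 2, and their number is even.  In both cases
    there is a path u, x1, x2, v whose two middle vertices have degree 2
    ([block_thread]).  Deleting x1 and x2 and making u and v adjacent preserves
    2-connectivity, the colouring and the oddness of all cycles ([block_contract]);
    it undoes a 3-path operation if u and v were adjacent before and a bisubdivision
    otherwise.  Induction ends with the 4-cycle.

    Conversely, both operations are iterations of the single step that restores
    the path u, x1, x2, v to a graph in which u and v are adjacent, keeping the
    edge uv or not.  This step preserves the following properties taken together:
    every vertex has at least two neighbours, every edge lies in a perfect
    matching, and every even cycle is conformal ([well_matched_thread]). *)

Set Implicit Arguments.
Unset Strict Implicit.
Unset Printing Implicit Defensive.

(** * Sequences and walks *)

(** Uniqueness of rearranged and shortened concatenations becomes linear arithmetic
    on multiplicities. *)
Lemma uniq_countP (T : eqType) (s : seq T) :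
  reflect (forall x, count_mem x s <= 1) (uniq s).
Proof.
apply: (iffP idP) => [us x|]; first by rewrite count_uniq_mem // leq_b1.
elim: s => //= x s IH cs; apply/andP; split.
  by rewrite -has_pred1 has_count; have := cs x; rewrite eqxx; lia.
by apply: IH => y; have := cs y; lia.
Qed.

(* Sizes and multiplicities are turned into plain numbers, and the context is
   dropped, before the linear arithmetic starts: it would otherwise reason about
   every boolean in sight. *)
Ltac goal_lia :=
  repeat match goal with |- context [nat_of_bool ?b] =>
    generalize (nat_of_bool b) end;
  repeat match goal with |- context [@count ?T ?a ?s] =>
    generalize (@count T a s) end;
  repeat match goal with |- context [@size ?T ?s] =>
    generalize (@size T s) end;
  clear; lia.

Ltac count_lia :=
  rewrite /= ?(count_cat, count_rev) /= ?(count_cat, count_rev) /=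
    ?(count_cat, count_rev) /=;
  goal_lia.

Ltac size_lia :=
  rewrite ?(size_cat, size_rev, size_rcons) /= ?(size_cat, size_rev, size_rcons) /=
    ?(size_cat, size_rev, size_rcons) /=;
  goal_lia.

Lemma cat_split (T : Type) (s1 t1 s2 t2 : seq T) :
  s1 ++ t1 = s2 ++ t2 -> size s1 <= size s2 ->
  exists2 d, s2 = s1 ++ d & t1 = d ++ t2.
Proof.
elim: s1 s2 => [|x s1 IH] [|y s2] //=; first by move=> ->; exists [::].
  by move=> ->; exists (y :: s2).
by case=> -> /IH{}IH /IH[d -> ->]; exists d.
Qed.

Definition avoiding (T : eqType) (e : rel T) (w : T) : rel T :=
  fun x y => [&& e x y, x != w & y != w].

Lemma path_split (T : Type) (e : rel T) a s w t b :
  path e a (rcons (s ++ w :: t) b) = path e a (rcons s w) && path e w (rcons t b).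
Proof. by rewrite rcons_cat rcons_cons -cat_rcons cat_path last_rcons. Qed.

Lemma path_color (T : eqType) (e : rel T) (col : pred T) a s b :
    (forall x y, e x y -> col x != col y) ->
  path e a (rcons s b) -> col b = col a (+) odd (size s).+1.
Proof.
move=> eC; elim: s a => [|y s IH] a /=.
  by rewrite andbT => /eC; case: (col a); case: (col b).
case/andP=> /eC ay /IH -> /=.
by move: ay; case: (col a); case: (col y); case: (odd (size s)).
Qed.

Lemma path_reverse (T : eqType) (e : rel T) a s b : symmetric e ->
  path e a (rcons s b) = path e b (rcons (rev s) a).
Proof.
move=> e_sym; have -> : rcons (rev s) a = rev (belast a (rcons s b)).
  by rewrite belast_rcons rev_cons.
rewrite -{2}[b](last_rcons a s b) rev_path.
by apply: eq_path => x y; rewrite e_sym.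
Qed.

Lemma avoiding_path (T : eqType) (e : rel T) w x s :
  path (avoiding e w) x s -> path e x s /\ w \notin s.
Proof.
elim: s x => //= y s IH x /andP[/and3P[-> _ yw] /IH[-> ws]].
by rewrite inE negb_or eq_sym yw ws.
Qed.

(** * Counting forward edges along a walk *)

Section Parity.
Variables (T : eqType) (D : rel T).

(** The walk is given by its first vertex and the others, as for [path]; [D x y]
    says that a step from [x] to [y] is forward. *)
Fixpoint par (x : T) (s : seq T) : bool :=
  if s is y :: s' then D x y (+) par y s' else false.

Lemma par_cat x s t : par x (s ++ t) = par x s (+) par (last x s) t.
Proof. by elim: s x => //= y s IH x; rewrite IH addbA. Qed.

Lemma par_rcons x s y : par x (rcons s y) = par x s (+) D (last x s) y.
Proof. by rewrite -cats1 par_cat /= addbF. Qed.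

Lemma par_rot x s y t :
  par x (rcons (s ++ y :: t) x) = par y (rcons (t ++ x :: s) y).
Proof.
rewrite !rcons_cat !par_cat /= !par_rcons.
by case: (par x s); case: (par y t); case: (D _ y); case: (D _ x).
Qed.

Variable e : rel T.
Hypothesis De : forall x y, e x y -> D x y = ~~ D y x.

(** Reversal exchanges forward and backward edges. *)
Lemma par_rev a s b : path e a (rcons s b) ->
  par b (rcons (rev s) a) = par a (rcons s b) (+) odd (size s).+1.
Proof.
elim: s a => [|y s IH] a /=.
  by rewrite andbT !addbF => /De ->; rewrite addbT negbK.
case/andP=> /De-> /IH{}IH; rewrite rev_cons par_rcons last_rcons IH /=.
by case: (par _ _); case: (odd _); case: (D _ _).
Qed.

End Parity.

Lemma next_cat (T : eqType) s (y : T) t : uniq (s ++ y :: t) ->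
  next (s ++ y :: t) y = head (head y s) t.
Proof.
move=> us; rewrite next_nth mem_cat mem_head orbT.
have -> : index y (s ++ y :: t) = size s.
  move: us; rewrite cat_uniq /= negb_or => /and3P[_ /andP[/negbTE ys _] _].
  by rewrite index_cat ys /= eqxx addn0.
case: s {us} => [|x s] /=; first by rewrite nth0.
by rewrite nth_cat ltnNge leqnSn subSnn -nth0.
Qed.

Lemma odd_count_next (T : eqType) (D : rel T) x (r : seq T) : uniq (x :: r) ->
  odd (count (fun z => D z (next (x :: r) z)) (x :: r)) = par D x (rcons r x).
Proof.
move=> uc; set c := x :: r in uc *.
suff H s y t : c = s ++ y :: t ->
    odd (count (fun z => D z (next c z)) (y :: t)) = par D y (rcons t x).
  exact: (H [::]).
have nE s' y' t' : c = s' ++ y' :: t' -> next c y' = head x t'.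
  move=> cE; rewrite cE next_cat -?cE //.
  by case: s' cE => [|? ?] [->].
have c1 (f : pred T) z : odd (count f [:: z]) = f z by rewrite /= addn0 oddb.
elim: t s y => [|z t IH] s y cE; first by rewrite c1 (nE _ _ _ cE) /= addbF.
rewrite -cat1s count_cat oddD (IH (rcons s y)); last by rewrite cat_rcons.
by rewrite c1 (nE _ _ _ cE).
Qed.

(** * Oddly oriented blocks and their thetas *)

(** The properties that survive the removal of a pair of adjacent vertices of
    degree 2.  The vertex set [V] and the relation [e] vary while the type stays
    fixed, so that an induction on the number of vertices needs no new types. *)
Record odd_block (T : finType) (V : {set T}) (e D : rel T) (col : pred T) :
    Prop := OddBlock {
  ob_sym : symmetric e;
  ob_in : forall x y, e x y -> x \in V;
  ob_conn : forall w x y, x \in V -> y \in V -> x != w -> y != w ->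
    connect (avoiding e w) x y;
  ob_col : forall x y, e x y -> col x != col y;
  ob_dir : forall x y, e x y -> D x y = ~~ D y x;
  ob_cycle : forall x r, 1 < size r -> uniq (x :: r) -> path e x (rcons r x) ->
    par D x (rcons r x) }.

(** Three internally disjoint [a]-[b]-paths, given by their interiors.  At most one
    of them may be a single edge, so any two of them form a cycle. *)
Record theta (T : eqType) (e : rel T) (a b : T) (s t p : seq T) : Prop := Theta {
  th_s : path e a (rcons s b);
  th_t : path e a (rcons t b);
  th_p : path e a (rcons p b);
  th_uniq : uniq (a :: b :: s ++ t ++ p);
  th_st : 0 < size s + size t;
  th_tp : 0 < size t + size p;
  th_sp : 0 < size s + size p }.

Section Thetas.
Variables (T : finType) (V : {set T}) (e D : rel T) (col : pred T).
Hypothesis B : odd_block V e D col.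

Let e_sym := ob_sym B.

Let path_col a s b := @path_color T e col a s b (ob_col B).

Let path_rev a s b := @path_reverse T e a s b e_sym.

Lemma two_paths_par a b p s :
    path e a (rcons p b) -> path e a (rcons s b) ->
    uniq (a :: b :: p ++ s) -> 0 < size p + size s ->
  par D a (rcons p b) (+) par D a (rcons s b) = odd (size s).
Proof.
move=> pp ps us sz; have := ob_cycle B (x := a) (r := p ++ b :: rev s).
have -> : rcons (p ++ b :: rev s) a = rcons p b ++ rcons (rev s) a.
  by rewrite cat_rcons rcons_cat.
rewrite par_cat last_rcons (par_rev (ob_dir B)) // cat_path last_rcons pp.
rewrite -path_rev ps size_cat /= size_rev.
move=> H; suff : par D a (rcons p b) (+) (par D a (rcons s b) (+) ~~ odd (size s)).
  by case: (par _ _ _); case: (par _ _ _); case: odd.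
apply: H => //; first by move: sz; size_lia.
rewrite -[X in is_true X]/(uniq (a :: p ++ b :: rev s)).
apply/uniq_countP=> x; move/uniq_countP/(_ x): us.
by count_lia.
Qed.

(** Each two of the three paths form an odd cycle.  In the sum of the three cycle
    parities every path occurs once forwards and once backwards, which leaves only
    the lengths: the number of odd lengths is odd.  As the lengths have the same
    parity, all are odd. *)
Lemma theta_col a b s t p : theta e a b s t p -> col a != col b.
Proof.
case=> ps pt pp /uniq_countP us st tp sp.
have [ust usp utp] : [/\ uniq (a :: b :: s ++ t), uniq (a :: b :: s ++ p)
    & uniq (a :: b :: t ++ p)].
  by split; apply/uniq_countP=> x; move: (us x); count_lia.
have := two_paths_par ps pt ust st; have := two_paths_par ps pp usp sp.
have := two_paths_par pt pp utp tp.
move: (path_col ps) (path_col pt) (path_col pp) => /=.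
case: (par _ _ (rcons s _)); case: (par _ _ (rcons t _)); case: (par _ _ (rcons p _));
  by case: odd; case: odd; case: odd; case: (col a); case: (col b).
Qed.

Lemma thetaC12 a b s t p : theta e a b s t p -> theta e a b t s p.
Proof.
case=> ps pt pp us st tp sp; split=> //; last by rewrite addnC.
apply/uniq_countP=> x; move/uniq_countP/(_ x): us.
by count_lia.
Qed.

Lemma thetaC23 a b s t p : theta e a b s t p -> theta e a b s p t.
Proof.
case=> ps pt pp us st tp sp; split=> //; last by rewrite addnC.
apply/uniq_countP=> x; move/uniq_countP/(_ x): us.
by count_lia.
Qed.

(** A third edge at a vertex [w] of a cycle starts an ear of that cycle: a chord, or
    a path outside the cycle that returns to it elsewhere because [w] is not a
    cutvertex.  The cycle and the ear form a theta. *)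
Lemma ear_theta w r y : 1 < size r -> uniq (w :: r) -> path e w (rcons r w) ->
    e w y -> y != head w r -> y != last w r ->
  exists s z t q, r = s ++ z :: t /\ theta e w z s (rev t) q.
Proof.
move=> sr ur pr wy yh yl.
have cyc s z t : r = s ++ z :: t ->
    path e w (rcons s z) && path e w (rcons (rev t) z).
  move=> rE; move: pr; have -> : rcons r w = rcons s z ++ rcons t w.
    by rewrite rE cat_rcons rcons_cat.
  rewrite cat_path last_rcons.
  by rewrite (path_rev z t).
have yw : y != w by apply: contraTneq (ob_col B wy) => ->; rewrite eqxx.
have [yr|yr] := boolP (y \in r).
  case/splitPr: r / yr sr ur pr yh yl cyc => s t sr ur pr yh yl cyc.
  exists s, y, t, [::]; split=> //.
  have /andP[? ?] := cyc _ _ _ (erefl _).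
  split; rewrite ?size_rev ?addn0 //; first by rewrite /= wy.
  - apply/uniq_countP=> x; move/uniq_countP/(_ x): ur.
    by rewrite cats0; count_lia.
  - by move: sr; size_lia.
  - by case: (t) yl => [|? ?] //=; rewrite last_cat /= eqxx.
  - by case: (s) yh => [|? ?] //=; rewrite eqxx.
have hr : head w r \in r by case: (r) sr => //= ? ? _; rewrite mem_head.
have hw : head w r != w by apply: contraTneq hr => ->; case/andP: ur.
have := ob_conn B (w := w) (x := y) (y := head w r).
rewrite (ob_in B (y := w)) 1?e_sym // (ob_in B (x := head w r) (y := w)); last first.
  by case: (r) sr pr => //= ? ? _ /andP[]; rewrite e_sym.
case/(_ isT isT yw hw)/connectP=> p0 /shortenP[p pp up _] {p0} pE.
have hp : has (mem r) p.
  apply/hasP; exists (head w r) => //.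
  by have := mem_last y p; rewrite inE -pE; case/predU1P=> // hy; rewrite -hy hr in yr.
case/split_find: hp pp up {pE} => z q1 p2 zr q1r pp up.
case/splitPr: r / zr {hr hw yh yl} sr ur pr yr q1r cyc => s t sr ur pr yr q1r cyc.
exists s, z, t, (y :: q1); split=> //.
have /andP[? ?] := cyc _ _ _ (erefl _).
have [pe wq] : path e y (rcons q1 z) /\ w \notin q1.
  have [+ wp] := avoiding_path pp; rewrite cat_path => /andP[-> _]; split=> //.
  by apply: contra wp => wq; rewrite mem_cat mem_rcons inE wq orbT.
split; rewrite ?addnS // ?size_rev; [by rewrite /= wy | | by move: sr; size_lia].
apply/uniq_countP=> x; move/uniq_countP/(_ x): ur; move/uniq_countP/(_ x): up => /=.
rewrite /= !count_cat -cats1 count_cat /= count_rev.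
have : x \in q1 -> x \notin s ++ z :: t.
  by move=> xq; apply: contra q1r => xs; apply/hasP; exists x.
case: (eqVneq w x) wq => [<- wq _|_ _]; last case: (eqVneq y x) => [yx|_].
- have /count_memPn -> := wq; rewrite (negbTE yw).
  by count_lia.
- by move: yr; rewrite yx => /count_memPn; count_lia.
case: (boolP (x \in q1)) => [xq /(_ isT)/count_memPn|/count_memPn-> _]; count_lia.
Qed.

End Thetas.

(** * Two adjacent vertices of degree 2 *)

Record thread (T : eqType) (e : rel T) (u x1 x2 v : T) : Prop := Thread {
  thr_ux : e u x1;
  thr_xx : e x1 x2;
  thr_xv : e x2 v;
  thr_uniq : uniq [:: u; x1; x2; v];
  thr_nb1 : forall y, e x1 y -> (y == u) || (y == x2);
  thr_nb2 : forall y, e x2 y -> (y == x1) || (y == v) }.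

Section Thread.
Variables (T : finType) (V : {set T}) (e D : rel T) (col : pred T).
Hypothesis B : odd_block V e D col.

Let e_sym := ob_sym B.

(** The interior of a second ear [q], from [w] to [z], either avoids that of the
    first one or meets it.  If they are disjoint, the cycle and the two ears form a
    subdivision of K4.  If they meet, [w] is joined to both [a] and [b] through the
    first meeting point.  Either way three vertices are pairwise branch vertices of
    thetas, hence pairwise of different colours. *)
Lemma no_crossing a b w z s1 s2 t1 t2 p q :
  theta e a b (s1 ++ w :: s2) (t1 ++ z :: t2) p ->
  theta e w z (s2 ++ b :: rev t2) (rev s1 ++ a :: t1) q -> False.
Proof.
move=> th1 th2; have ab := theta_col B th1; have wz := theta_col B th2.
case: th1; rewrite !path_split => /andP[as1 s2b] /andP[at1 t2b] pp u1 _ _ _.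
case: th2 => _ _ pq u2 _ _ _.
have [qp|qp] := boolP (has (mem p) q).
  case/split_find: qp pq u2 => m q1 q2 mp q1p pq u2.
  case/splitPr: p / mp pp u1 q1p => p1 p2; rewrite path_split => /andP[ap1 p2b] u1 q1p.
  have {}pq : path e w (rcons q1 m).
    by move: pq; rewrite rcons_cat cat_path => /andP[].
  have q1p' x : x \in q1 -> count_mem x (p1 ++ m :: p2) = 0.
    by move=> xq; apply/count_memPn; apply: contra q1p => xp; apply/hasP; exists x.
  have wa : col w != col a.
    apply: (theta_col B (s := rev s1) (t := s2 ++ b :: rev t2 ++ z :: rev t1)
        (p := q1 ++ m :: rev p1)).
    split; rewrite ?path_split -?(path_reverse _ _ _ e_sym) ?as1 ?s2b ?at1 ?t2b ?pq //;
      try by size_lia.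
    apply/uniq_countP=> x; move/uniq_countP/(_ x): u1; move/uniq_countP/(_ x): u2 => /=.
    rewrite -cats1 !(count_cat, count_rev) /= ?(count_cat, count_rev) /=.
    by case: (boolP (x \in q1)) => [/q1p'|/count_memPn->]; count_lia.
  have wb : col w != col b.
    apply: (theta_col B (s := s2) (t := rev s1 ++ a :: t1 ++ z :: t2)
        (p := q1 ++ m :: p2)).
    split; rewrite ?path_split -?(path_reverse _ _ _ e_sym) ?as1 ?s2b ?at1 ?t2b ?pq //;
      try by size_lia.
    apply/uniq_countP=> x; move/uniq_countP/(_ x): u1; move/uniq_countP/(_ x): u2 => /=.
    rewrite -cats1 !(count_cat, count_rev) /= ?(count_cat, count_rev) /=.
    by case: (boolP (x \in q1)) => [/q1p'|/count_memPn->]; count_lia.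
  by move: ab wa wb; case: (col a); case: (col b); case: (col w).
have qp' x : x \in q -> count_mem x p = 0.
  by move=> xq; apply/count_memPn; apply: contra qp => xp; apply/hasP; exists x.
have aw : col a != col w.
  apply: (theta_col B (s := s1) (t := p ++ b :: rev s2)
      (p := t1 ++ z :: rev q)).
  split; rewrite ?path_split -?(path_reverse _ _ _ e_sym) ?as1 ?s2b ?at1 ?t2b ?pp ?pq //;
    try by size_lia.
  apply/uniq_countP=> x; move/uniq_countP/(_ x): u1; move/uniq_countP/(_ x): u2 => /=.
  rewrite /= !(count_cat, count_rev) /= ?(count_cat, count_rev) /=.
  by case: (boolP (x \in q)) => [/qp'|/count_memPn->]; count_lia.
have az : col a != col z.
  apply: (theta_col B (s := t1) (t := p ++ b :: rev t2)
      (p := s1 ++ w :: q)).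
  split; rewrite ?path_split -?(path_reverse _ _ _ e_sym) ?as1 ?s2b ?at1 ?t2b ?pp ?pq //;
    try by size_lia.
  apply/uniq_countP=> x; move/uniq_countP/(_ x): u1; move/uniq_countP/(_ x): u2 => /=.
  rewrite /= !(count_cat, count_rev) /= ?(count_cat, count_rev) /=.
  by case: (boolP (x \in q)) => [/qp'|/count_memPn->]; count_lia.
by move: aw az wz; case: (col a); case: (col w); case: (col z).
Qed.

(** An inner vertex [w] of [s] with a third edge starts an ear of the cycle formed by
    [s] and [t].  As that ear cannot cross [p], its other end lies on [s] or is one of
    [a] and [b], and then it cuts off a shorter arc of the same cycle. *)
Lemma theta_shrink a b s1 w s2 t p y :
    theta e a b (s1 ++ w :: s2) t p ->
    e w y -> y != last a s1 -> y != head b s2 ->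
  exists a' b' s' t' p', [/\ theta e a' b' s' t' p',
    size s' < size (s1 ++ w :: s2)
    & size s' + size t' = size (s1 ++ w :: s2) + size t].
Proof.
move=> th wy yl yh; set r := s2 ++ b :: rev t ++ a :: s1.
have [|||||s' [z [t' [q [rE th2]]]]] := ear_theta B (w := w) (r := r) _ _ _ wy.
- case: th => _ _ _ _ + _ _; rewrite /r; size_lia.
- apply/uniq_countP=> x; case: th => _ _ _ /uniq_countP/(_ x) + _ _ _.
  by rewrite /r; count_lia.
- case: th; rewrite !path_split => /andP[as1 s2b] tb _ _ _ _ _.
  by rewrite s2b as1 -(path_reverse _ _ _ e_sym) tb.
- by rewrite /r; case: (s2) yh.
- by rewrite /r last_cat /= last_cat.
have sz : size s' + size t' = size (s1 ++ w :: s2) + size t.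
  by move: (congr1 size rE); size_lia.
have [les|lts] := leqP (size s') (size s2).
  exists w, z, s', (rev t'), q; rewrite size_rev; split=> //.
  by move: les; size_lia.
have [let'|ltt] := leqP (size t') (size s1).
  exists w, z, (rev t'), s', q; rewrite size_rev; split=> //.
  - exact: thetaC12.
  - by move: let'; size_lia.
  - by rewrite addnC.
exfalso.
have rE' : rcons s2 b ++ (rev t ++ a :: s1) = s' ++ z :: t' by rewrite cat_rcons.
have [|d s'E] := cat_split rE'; first by rewrite size_rcons.
move=> dE.
have dE' : rcons d z ++ t' = rev t ++ a :: s1 by rewrite cat_rcons.
have [|d' tE t'E] := cat_split dE'.
  by move: ltt (congr1 size dE); size_lia.
have {}tE : t = rev d' ++ z :: rev d.
  by rewrite -[t]revK tE cat_rcons rev_cat rev_cons cat_rcons.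
apply: (@no_crossing a b w z s1 s2 (rev d') (rev d) p q); first by rewrite -tE.
by move: th2; rewrite s'E t'E revK rev_cat rev_cons !cat_rcons.
Qed.

Lemma two_neighbors_or_third x l r : (forall y, e x y -> (y == l) || (y == r)) \/
  exists y, [/\ e x y, y != l & y != r].
Proof.
have [/existsP[y /and3P[]]|/existsPn H] := boolP [exists y, [&& e x y, y != l & y != r]].
  by right; exists y.
by left=> y xy; move: (H y); rewrite xy /= -negb_or negbK.
Qed.

(** The measure prefers long cycles, formed by [s] and [t], and then short paths
    [s]. *)
Lemma theta_thread a b s t p : theta e a b s t p -> exists u x1 x2 v, thread e u x1 x2 v.
Proof.
have [m le_m] := ubnP ((#|T| - (size s + size t)) * #|T|.+1 + size s).
elim: m a b s t p le_m => // m IH a b s t p le_m th.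
have bound a' b' s' t' p' : theta e a' b' s' t' p' -> size s' + size t' + size p' <= #|T|.
  case=> _ _ _ u _ _ _; apply: leq_trans (max_card (mem (a' :: b' :: s' ++ t' ++ p'))).
  by rewrite (card_uniqP u) /= !size_cat; lia.
have shrink s1 w s2 y : s = s1 ++ w :: s2 -> e w y -> y != last a s1 ->
    y != head b s2 -> exists u x1 x2 v, thread e u x1 x2 v.
  move=> sE wy yl yh; rewrite sE in th.
  have [a' [b' [s' [t' [p' [th' lt_s sz]]]]]] := theta_shrink th wy yl yh.
  by apply: IH th'; move: le_m; rewrite sz sE; lia.
case: s => [|x1 [|x2 s]] in th le_m shrink *.
(* An empty interior of [s] is exchanged with that of [p], which lengthens the
   cycle. *)
- have := bound _ _ _ _ _ th; case: (th) => _ _ _ _ _ _ /= p0 bd.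
  apply: (IH a b p t [::]); last exact/thetaC12/thetaC23/thetaC12.
  rewrite /= in le_m; rewrite ltnS in le_m; apply: leq_trans le_m.
  move: p0 bd; rewrite /= !add0n addn0; move: #|T| (size p) (size t) => N i j i0 le_N.
  have -> : N - j = N - (i + j) + i by lia.
  by rewrite mulnDl; nia.
(* A single inner vertex would give [a] and [b] the same colour. *)
- have := theta_col B th; case: th => /(path_color (ob_col B)) /= ->.
  by case: (col a).
have [nb1|[y [xy yl yr]]] := two_neighbors_or_third x1 a x2;
  last exact: (shrink [::] x1 (x2 :: s) y).
have [nb2|[y [xy yl yr]]] := two_neighbors_or_third x2 x1 (head b s);
  last exact: (shrink [:: x1] x2 s y).
case: th => + _ _ u _ _ _; rewrite /= => /and3P[ax xx ps].
exists a, x1, x2, (head b s); split=> //.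
  by case: (s) ps => [|? ?] /= /andP[].
apply/uniq_countP=> x; move/uniq_countP/(_ x): u.
by case: (s) => [|x3 s']; count_lia.
Qed.

Lemma block_neighbor x y : 2 < #|V| -> x \in V -> x != y -> exists2 z, e x z & z != y.
Proof.
move=> V3 xV xy.
have [z zV] : exists2 z, z \in V & (z != x) && (z != y).
  have /subsetPn[z zV nz] : ~~ (V \subset [set x; y]).
    by apply: contraL V3 => /subset_leq_card; rewrite cards2 -leqNgt xy.
  by exists z => //; rewrite !inE negb_or in nz.
case/andP=> zx zy; have /connectP[[|c p] /= pp zE] := ob_conn B xV zV xy zy.
  by rewrite zE eqxx in zx.
by case/andP: pp => /and3P[xc _ cy] _; exists c.
Qed.

(** A cycle exists because degrees are at least 2.  Either two consecutive vertices
    of it already have degree 2, or an ear turns it into a theta. *)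
Lemma block_thread : 2 < #|V| -> exists u x1 x2 v, thread e u x1 x2 v.
Proof.
move=> V3.
have [x xV] : exists x, x \in V by apply/card_gt0P; lia.
have [y0 y0V yx0] : exists2 y, y \in V & y != x.
  have /subsetPn[z zV nz] : ~~ (V \subset [set x]).
    by apply: contraL V3 => /subset_leq_card; rewrite cards1 -leqNgt => /leq_trans->.
  by exists z => //; rewrite !inE in nz.
have [y xy _] : exists2 y, e x y & y != y0 by apply: block_neighbor; rewrite // eq_sym.
have neq a b : e a b -> a != b.
  by move=> ab; apply: contraTneq (ob_col B ab) => ->; rewrite eqxx.
have yx := neq _ _ xy; have [z xz zy] := block_neighbor V3 xV yx.
have := ob_conn B (w := x) (x := y) (y := z).
rewrite (ob_in B (y := x)) 1?e_sym // (ob_in B (y := x)) 1?e_sym // eq_sym yx.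
rewrite eq_sym (neq _ _ xz) => /(_ isT isT isT isT)/connectP[p0 /shortenP[p pp up _]] {p0}.
case: p pp up => [|v p] pp up zE; first by rewrite zE eqxx in zy.
have [pe xvp] := avoiding_path pp.
have xp : x \notin [:: y, v & p] by rewrite inE negb_or yx.
have uc : uniq [:: x, y, v & p] by rewrite cons_uniq xp.
have pc : path e x (rcons [:: y, v & p] x).
  by rewrite /= xy; move: pe => /= /andP[-> pe]; rewrite rcons_path pe -[last _ _]zE e_sym.
have [nb1|[t [xt tl tr]]] := two_neighbors_or_third x y z; last first.
  have {}tr : t != last x [:: y, v & p] by rewrite /= -[last _ _]zE.
  have [s [c [? [q [_ th]]]]] := ear_theta B (r := [:: y, v & p]) isT uc pc xt tl tr.
  exact: theta_thread th.
have [nb2|[t [yt tl tr]]] := two_neighbors_or_third y v x; last first.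
  have sz : 1 < size (rcons (v :: p) x) by rewrite size_rcons.
  have u' : uniq (y :: rcons (v :: p) x) by rewrite -rcons_cons rcons_uniq xp.
  have p' : path e y (rcons (rcons (v :: p) x) y).
    by rewrite !rcons_path pe last_rcons -zE e_sym xz.
  have {}tr : t != last y (rcons (v :: p) x) by rewrite last_rcons.
  have [s [c [? [q [_ th]]]]] := ear_theta B sz u' p' yt tl tr.
  exact: theta_thread th.
have yv : e y v by case/andP: pe.
have zv : z != v.
  apply: contraTneq (ob_col B xz) => ->; move: (ob_col B xy) (ob_col B yv).
  by case: (col x); case: (col y); case: (col v).
have zP : z \in v :: p by rewrite zE /= mem_last.
have uz : uniq [:: z; x; y; v].
  have zy' : z != y by [].
  have zx : z != x by rewrite eq_sym neq.
  move: xp up; rewrite /= !inE !negb_or zx zy' zv yx.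
  by case/and3P=> _ -> _ /andP[/andP[-> _] _].
exists z, x, y, v; split=> //; first by rewrite e_sym.
- by move=> h /nb1; rewrite orbC.
- by move=> h /nb2; rewrite orbC.
Qed.

End Thread.

(** * Replacing a path of length 3 by an edge *)

Section Contraction.
Variables (T : eqType) (e D : rel T) (u x1 x2 v : T).

Definition contract : rel T := fun x y =>
  [|| [&& e x y, x \notin [:: x1; x2] & y \notin [:: x1; x2]],
      (x == u) && (y == v) | (x == v) && (y == u)].

(** The direction of the new edge is chosen with the parity of the path that it
    replaces. *)
Definition contract_dir : rel T := fun x y =>
  if (x == u) && (y == v) then par D u [:: x1; x2; v]
  else if (x == v) && (y == u) then par D v [:: x2; x1; u]
  else D x y.

End Contraction.

Lemma contractC (T : eqType) (e : rel T) u x1 x2 v :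
  contract e v x2 x1 u =2 contract e u x1 x2 v.
Proof.
move=> x y; rewrite /contract !inE ![(_ == x2) || _]orbC; congr (_ || _).
by rewrite orbC.
Qed.

Lemma contract_dirC (T : eqType) (D : rel T) u x1 x2 v : u != v ->
  contract_dir D v x2 x1 u =2 contract_dir D u x1 x2 v.
Proof.
rewrite eq_sym => /negbTE vu x y; rewrite /contract_dir.
by case: (eqVneq x v) => [->|_] /=; rewrite ?vu.
Qed.

Lemma eq_par (T : eqType) (D D' : rel T) : D =2 D' ->
  forall x s, par D x s = par D' x s.
Proof. by move=> DD' x s; elim: s x => //= y s IH x; rewrite IH DD'. Qed.

Lemma thread_sym (T : eqType) (e : rel T) u x1 x2 v : symmetric e ->
  thread e u x1 x2 v -> thread e v x2 x1 u.
Proof.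
move=> se [? ? ? un nb1 nb2]; split; rewrite 1?se //.
- by rewrite -rev_uniq.
- by move=> y /nb2; rewrite orbC.
- by move=> y /nb1; rewrite orbC.
Qed.

Lemma thread_neq (T : eqType) (e : rel T) u x1 x2 v : thread e u x1 x2 v ->
  [/\ u != v, u \notin [:: x1; x2] & v \notin [:: x1; x2]].
Proof.
move/thr_uniq; rewrite /= !inE !negb_or.
case/and4P=> /and3P[-> -> ->] /andP[_ v1] v2 _.
by rewrite ![v == _]eq_sym v1 v2.
Qed.

Lemma thread_neq12 (T : eqType) (e : rel T) u x1 x2 v :
  thread e u x1 x2 v -> x1 != x2.
Proof.
by move/thr_uniq; rewrite /= !inE !negb_or => /and4P[_ /andP[]].
Qed.

Section ContractCycle.
Variables (T : eqType) (e D : rel T) (u x1 x2 v : T).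
Hypotheses (th : thread e u x1 x2 v).
Hypothesis odd_cycles : forall x r, 1 < size r -> uniq (x :: r) ->
  path e x (rcons r x) -> par D x (rcons r x).

Let e' := contract e u x1 x2 v.
Let D' := contract_dir D u x1 x2 v.

Lemma contract_off x y : e' x y -> y \notin [:: x1; x2].
Proof.
have [_ un vn] := thread_neq th.
by case/or3P=> [/and3P[]|/andP[_ /eqP->]|/andP[_ /eqP->]].
Qed.

Lemma contract_cycle_off x r : path e' x (rcons r x) ->
  all (fun y => y \notin [:: x1; x2]) (x :: r).
Proof.
rewrite [all _ _]/= -(all_rcons (fun y => y \notin [:: x1; x2]) r x).
by move: (rcons r x) => s; elim: s x => //= y s IH z /andP[/contract_off-> /IH].
Qed.

Lemma contract_edge x y : ~~ ((x == u) && (y == v)) -> ~~ ((x == v) && (y == u)) ->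
  e' x y -> e x y /\ D' x y = D x y.
Proof.
move=> n1 n2; rewrite /e' /D' /contract /contract_dir (negbTE n1) (negbTE n2) /= orbF.
by case/and3P.
Qed.

Lemma contract_path x s : u \notin x :: s -> path e' x s ->
  path e x s /\ par D' x s = par D x s.
Proof.
elim: s x => //= y s IH x; rewrite inE negb_or => /andP[ux uys] /andP[xy ys].
have [pys ->] := IH _ uys ys.
have uy : y != u by move: uys; rewrite inE negb_or eq_sym => /andP[].
have [||-> ->] := contract_edge _ _ xy; first by rewrite eq_sym (negbTE ux).
  by rewrite (negbTE uy) andbF.
by rewrite pys.
Qed.

(** A cycle through the new edge is expanded to one through [x1] and [x2], which has
    the same parity. *)
Lemma contract_cycle_through r : 0 < size r -> uniq [:: u, v & r] ->
  path e' u (rcons (v :: r) u) -> par D' u (rcons (v :: r) u).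
Proof.
move=> r0 un pr; have off := contract_cycle_off pr.
move: pr; rewrite /= rcons_path par_rcons => /and3P[_ pr vu].
have [|pe ->] := contract_path _ pr; first by case/andP: un.
have lv : last v r != v.
  move: un => /= /and3P[_ + _]; case: (r) r0 => //= y s _; apply: contra => /eqP <-.
  exact: mem_last.
have [||ve ->] := contract_edge _ _ vu; rewrite ?(negbTE lv) //.
  have : last v r != u by apply: contraTneq un => <-; rewrite /= mem_last.
  by move/negbTE->.
have := odd_cycles (x := u) (r := [:: x1, x2, v & r]).
rewrite [par _ _ _ in X in _ -> X]/= par_rcons /D' /contract_dir !eqxx /= addbF !addbA.
apply=> //; last by rewrite (thr_ux th) (thr_xx th) (thr_xv th) rcons_path pe.
move: off (thr_uniq th) un => /=; rewrite !inE !negb_or.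
case/and3P=> /andP[u1 u2] /andP[v1 v2] off /and4P[/and3P[-> -> _] /andP[-> _] _ _].
case/and3P=> /andP[-> ->] -> ->; rewrite !(eq_sym _ v) v1 v2 !andbT /=.
by apply/andP; split; apply/negP=> /(allP off); rewrite !inE eqxx ?orbT.
Qed.

End ContractCycle.

Lemma contract_odd_cycles (T : eqType) (e D : rel T) u x1 x2 v :
    symmetric e -> (forall x y, e x y -> D x y = ~~ D y x) ->
    thread e u x1 x2 v ->
    (forall x r, 1 < size r -> uniq (x :: r) ->
      path e x (rcons r x) -> par D x (rcons r x)) ->
  forall x r, 1 < size r -> uniq (x :: r) ->
    path (contract e u x1 x2 v) x (rcons r x) ->
  par (contract_dir D u x1 x2 v) x (rcons r x).
Proof.
move=> se De th oddc x r sr ur pr.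
have [ux|ux] := boolP (u \in x :: r); last first.
  have [|pe ->] := contract_path D _ pr.
    by rewrite -rcons_cons mem_rcons inE negb_or ux andbT; case/norP: ux.
  exact: oddc.
have {x r ux sr ur pr}[r [-> sr ur pr]] : exists r', [/\
    par (contract_dir D u x1 x2 v) x (rcons r x) =
      par (contract_dir D u x1 x2 v) u (rcons r' u),
    1 < size r', uniq (u :: r') & path (contract e u x1 x2 v) u (rcons r' u)].
  move: ux; rewrite inE => /predU1P[ux|]; first by rewrite -ux in ur pr *; exists r.
  move=> ur'; case/splitPr: r / ur' sr ur pr => s t sr ur pr; exists (t ++ x :: s); split.
  - exact: par_rot.
  - by move: sr; size_lia.
  - by apply/uniq_countP=> y; move/uniq_countP/(_ y): ur; count_lia.
  - by move: pr; rewrite !path_split andbC.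
have [uv _ _] := thread_neq th.
have [hv|hv] := eqVneq (head u r) v.
  case: r sr ur pr hv => // y r sr ur pr yv; move: yv sr ur pr => /= -> sr ur pr.
  exact: contract_cycle_through th oddc _ sr ur pr.
have [lv|lv] := eqVneq (last u r) v.
  case/lastP: r sr ur pr hv lv => // r y sr ur pr hv.
  rewrite last_rcons => yv; rewrite {y}yv in sr ur pr hv *.
  have -> : par (contract_dir D u x1 x2 v) u (rcons (rcons r v) u) =
    par (contract_dir D v x2 x1 u) v (rcons (u :: r) v).
    by rewrite -(eq_par (contract_dirC _ _ _ uv)) -[rcons r v]cats1 par_rot.
  apply: contract_cycle_through (thread_sym se th) oddc _ _ _ _.
  - by move: sr; rewrite size_rcons.
  - by apply/uniq_countP=> y; move/uniq_countP/(_ y): ur; rewrite -cats1; count_lia.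
  - rewrite (eq_path (contractC _ _ _ _ _)).
    by move: pr; rewrite -[rcons r v]cats1 path_split /= andbT andbC.
case: r sr ur pr hv lv => // y r sr ur pr /= hv lv.
move: pr ur; rewrite /= rcons_path => /and3P[uy pr ru] ur.
have [||euy Duy] := contract_edge D _ _ uy; rewrite ?(negbTE hv) ?andbF ?(negbTE uv) //.
have lu : last y r != u.
  by apply: contraTneq ur => <-; rewrite mem_last.
have [||eru Dru] := contract_edge D _ _ ru; rewrite ?(negbTE lv) ?(negbTE lu) //.
have [|pe pE] := contract_path D _ pr; first by case/andP: ur.
have := oddc u (y :: r) sr ur.
rewrite /= !par_rcons Duy Dru pE; apply.
by rewrite rcons_path euy pe.
Qed.

Lemma connect_homo (T : finType) (R R' : rel T) (f : T -> T) :
    (forall a b, R a b -> connect R' (f a) (f b)) ->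
  forall x y, connect R x y -> connect R' (f x) (f y).
Proof.
move=> fR x _ /connectP[p pp ->]; elim: p x pp => //= y p IH x /andP[xy /IH].
exact/connect_trans/fR.
Qed.

(** For 2-connectivity [x1] and [x2] are mapped to an end of the new edge that is not
    the deleted vertex [w]; edges then go to edges or collapse. *)
Lemma block_contract (T : finType) (V : {set T}) (e D : rel T) (col : pred T) u x1 x2 v :
    odd_block V e D col -> thread e u x1 x2 v ->
  odd_block (V :\: [set x1; x2]) (contract e u x1 x2 v) (contract_dir D u x1 x2 v) col.
Proof.
move=> B th; have se := ob_sym B.
have [uv un vn] := thread_neq th.
have cuv : col u != col v.
  move: (ob_col B (thr_ux th)) (ob_col B (thr_xx th)) (ob_col B (thr_xv th)).
  by case: (col u); case: (col x1); case: (col x2); case: (col v).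
have sc : symmetric (contract e u x1 x2 v).
  move=> x y; rewrite /contract se; congr (_ || _); first by rewrite [_ && (x \notin _)]andbC.
  by rewrite orbC [(x == v) && _]andbC [(y == v) && _]andbC.
split=> //.
- move=> x y /or3P[/and3P[xy xn _]|/andP[/eqP-> _]|/andP[/eqP-> _]].
  + by move: xn; rewrite !inE => ->; rewrite (ob_in B xy).
  + by move: un; rewrite !inE => ->; rewrite (ob_in B (thr_ux th)).
  + move: vn; rewrite !inE => ->.
    by apply: (ob_in B (y := x2)); rewrite se (thr_xv th).
- move=> w x y; rewrite !inE !negb_or => /andP[/andP[xn1 xn2] xV].
  move=> /andP[/andP[yn1 yn2] yV] xw yw.
  pose f z := if z \in [:: x1; x2] then (if w == u then v else u) else z.
  have fx : f x = x by rewrite /f !inE (negbTE xn1) (negbTE xn2).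
  have fy : f y = y by rewrite /f !inE (negbTE yn1) (negbTE yn2).
  rewrite -fx -fy; apply: connect_homo (ob_conn B xV yV xw yw) => a b /and3P[ab aw bw].
  have fuv p q : (p == u) && (q == v) || (p == v) && (q == u) -> p != w -> q != w ->
      connect (avoiding (contract e u x1 x2 v) w) p q.
    by move=> pq pw qw; apply: connect1; rewrite /avoiding /contract pq orbT pw.
  have hop a' b' : e a' b' -> a' \in [:: x1; x2] -> b' \notin [:: x1; x2] ->
      b' != w -> connect (avoiding (contract e u x1 x2 v) w) (f a') b' /\
      connect (avoiding (contract e u x1 x2 v) w) b' (f a').
    rewrite /f => + a'n; rewrite a'n; move: a'n; rewrite !inE => /orP[]/eqP->.
      by case/(thr_nb1 th)/orP=> /eqP->; rewrite ?eqxx ?orbT // [w == u]eq_sym => _ /negbTE->.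
    case/(thr_nb2 th)/orP=> /eqP->; rewrite ?eqxx ?orbT // => _ vw.
    have [//|wu] := eqVneq w u.
    by split; apply: fuv; rewrite ?eqxx ?orbT // eq_sym.
  have [an|an] := boolP (a \in [:: x1; x2]); have [bn|bn] := boolP (b \in [:: x1; x2]).
  + by rewrite /f an bn.
  + by rewrite {2}/f (negbTE bn); case: (hop a b).
  + by rewrite {1}/f (negbTE an); case: (hop b a); rewrite // se.
  + rewrite /f (negbTE an) (negbTE bn); apply: connect1.
    by rewrite /avoiding /contract ab an bn aw bw.
- move=> x y /or3P[/and3P[/(ob_col B)//]|/andP[/eqP-> /eqP->]|/andP[/eqP-> /eqP->]] //.
  by rewrite eq_sym.
- move=> x y xy; rewrite /contract_dir.
  have D1 := ob_dir B (thr_ux th); have D2 := ob_dir B (thr_xx th).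
  have D3 := ob_dir B (thr_xv th).
  have vu : (v == u) = false by rewrite eq_sym (negbTE uv).
  have [/andP[/eqP-> /eqP->]|n1] := boolP ((x == u) && (y == v)).
    rewrite vu !eqxx /= D1 D2 D3 !addbF.
    by case: (D x1 u); case: (D x2 x1); case: (D v x2).
  have [/andP[/eqP-> /eqP->]|n2] := boolP ((x == v) && (y == u)).
    rewrite !eqxx /= D1 D2 D3 !addbF.
    by case: (D x1 u); case: (D x2 x1); case: (D v x2).
  rewrite [(y == u) && _]andbC (negbTE n2) [(y == v) && _]andbC (negbTE n1).
  by move: xy; rewrite /contract (negbTE n1) (negbTE n2) /= orbF => /and3P[/(ob_dir B)].
- exact: contract_odd_cycles (ob_dir B) th (ob_cycle B).
Qed.

(** * Realising blocks by constructible graphs *)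

Lemma path_edge_cons (T : eqType) (x y : T) s :
  path_edge (x :: y :: s) =2 fun a b =>
    [|| (a == x) && (b == y), (a == y) && (b == x) | path_edge (y :: s) a b].
Proof.
move=> a b; rewrite /path_edge !(infix_consl _ x) !prefix_cons !prefix0s !andbT.
rewrite [(b == x) && _]andbC.
by case: (_ && _); case: (_ && _); rewrite ?orbT.
Qed.

Lemma path_edge1 (T : eqType) (x : T) : path_edge [:: x] =2 fun _ _ => false.
Proof. by move=> a b; rewrite /path_edge !infixs1 /= !eqseq_cons !andbF. Qed.

Lemma set2_eq (T : finType) (x y a b : T) :
  ([set x; y] == [set a; b]) = ((x == a) && (y == b)) || ((x == b) && (y == a)).
Proof.
apply/eqP/orP => [E|[]/andP[/eqP-> /eqP->] //]; last by rewrite setUC.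
have: y \in [set a; b] by rewrite -E set22.
have: x \in [set a; b] by rewrite -E set21.
have: a \in [set x; y] by rewrite E set21.
have: b \in [set x; y] by rewrite E set22.
rewrite !inE; case: (eqVneq x a) => [->|_].
  rewrite /= [b == y]eq_sym; case: (eqVneq y b) => [_|_] /=; first by left.
  by rewrite !orbF => /eqP-> _ _ ya; right; rewrite eqxx.
by case: (eqVneq x b) => //= _ _ + _ _; rewrite eq_sym => ->; right.
Qed.

Definition realizes (T : finType) (V : {set T}) (e : rel T) (H : sgraph) : Prop :=
  exists f : H -> T, [/\ injective f, forall x, f x \in V,
    forall y, y \in V -> exists x, y = f x & {mono f : x y / sedge x y >-> e x y}].

Lemma new_path2 (T : finType) (u v : T) :
  new_path u v 2 = [:: inl u; inr ord0; inr (lift ord0 ord0); inl v].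
Proof. by rewrite /new_path enum_ordSl enum_ordSl (size0nil (size_enum_ord 0)). Qed.

Section Realize.
Variables (T : finType) (V : {set T}) (e : rel T) (u x1 x2 v : T).
Hypotheses (e_sym : symmetric e) (e_irr : irreflexive e) (th : thread e u x1 x2 v).
Hypothesis e_in : forall x y, e x y -> x \in V.

(** The last operation is the 3-path operation if [u] and [v] are adjacent in [e],
    and otherwise a bisubdivision by two vertices. *)
Lemma contract_realizes H :
    C4_constructible H ->
    realizes (V :\: [set x1; x2]) (contract e u x1 x2 v) H ->
  exists2 K, C4_constructible K & realizes V e K.
Proof.
move=> cH [f [f_inj f_in f_on f_mono]].
have [uv un vn] := thread_neq th.
have x1V : x1 \in V by apply: (e_in (y := x2)); case: th.
have x2V : x2 \in V by apply: (e_in (y := v)); case: th.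
have x12 := thread_neq12 th.
have uV : u \in V by apply: (e_in (y := x1)); case: th.
have vV : v \in V by apply: (e_in (y := x2)); rewrite e_sym; case: th.
have [a fa] : exists a, u = f a by apply: f_on; rewrite !inE in un *; rewrite un.
have [b fb] : exists b, v = f b by apply: f_on; rewrite !inE in vn *; rewrite vn.
have ab : sedge a b by rewrite -f_mono -fa -fb /contract !eqxx /= orbT.
have fn x : f x \notin [:: x1; x2] by have := f_in x; rewrite !inE => /andP[].
have fx1 x : e (f x) x1 = (x == a).
  rewrite -(inj_eq f_inj) -fa e_sym; apply/idP/eqP => [|->].
    by case/(thr_nb1 th)/orP=> /eqP // E; have := fn x; rewrite E !inE eqxx orbT.
  by rewrite e_sym; case: th.
have fx2 x : e (f x) x2 = (x == b).
  rewrite -(inj_eq f_inj) -fb e_sym; apply/idP/eqP => [|->].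
    by case/(thr_nb2 th)/orP=> /eqP // E; have := fn x; rewrite E !inE eqxx.
  by case: th.
pose F (z : H + 'I_2) := match z with inl x => f x | inr i => if i == ord0 then x1 else x2 end.
have [F_inj F_in F_on] : [/\ injective F, forall x, F x \in V &
    forall y, y \in V -> exists x, y = F x].
  split.
  - move=> [x|[[|[|//]] i]] [y|[[|[|//]] j]] //=;
      try by [move/f_inj->|move=> _; congr inr; apply: val_inj].
    + by move=> E; have := fn x; rewrite E !inE eqxx.
    + by move=> E; have := fn x; rewrite E !inE eqxx orbT.
    + by move=> E; have := fn y; rewrite -E !inE eqxx.
    + by move=> E; rewrite E eqxx in x12.
    + by move=> E; have := fn y; rewrite -E !inE eqxx orbT.
    + by move=> E; rewrite E eqxx in x12.
  - by move=> [x|i] /=; [have := f_in x; rewrite inE => /andP[] | case: ifP].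
  - move=> y yV; have [->|y1] := eqVneq y x1; first by exists (inr ord0).
    have [->|y2] := eqVneq y x2; first by exists (inr (lift ord0 ord0)).
    have [|x ->] := f_on y; first by rewrite !inE negb_or y1 y2.
    by exists (inl x).
have F_path x y : path_edge (new_path a b 2) x y =
    match x, y with inl _, inl _ => false | _, _ => e (F x) (F y) end.
  rewrite new_path2 !path_edge_cons path_edge1.
  case: x y => [x|[[|[|//]] i]] [y|[[|[|//]] j]];
    rewrite /= -?[inl _ == inl _]/(_ == _) -?[inr _ == inr _]/(_ == _)
      -?[inr _ == inl _]/false -?[inl _ == inr _]/false ?andbF ?orbF ?andbT ?e_irr //=.
  - by rewrite e_sym fx1.
  - by rewrite (thr_xx th).
  - by rewrite e_sym fx2.
  - by rewrite e_sym (thr_xx th).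
have [euv|euv] := boolP (e u v).
  exists (three_path ab); first exact: constr_three_path.
  rewrite /realizes; exists F; split=> // x y.
  rewrite /= /add_path_rel F_path.
  case: x y => [x|i] [y|j] //=; rewrite orbF -f_mono /contract !fn !andbT.
  apply/idP/orP => [|[] //]; first by left.
  by case/orP => /andP[/eqP-> /eqP->] //; rewrite e_sym.
exists (bisubdivision 1 ab); first exact: constr_bisubdivision.
rewrite /realizes; exists F; split=> // x y; rewrite /= /subdivide_rel F_path.
case: x y => [x|i] [y|j] //=; rewrite orbF -f_mono /contract !fn !andbT.
rewrite set2_eq.
have E c d : (@inl H 'I_2 c == inl d) = (f c == f d) by rewrite (inj_eq f_inj).
rewrite !E -fa -fb; apply/idP/andP => [xy|[/orP[]// -> //]].
rewrite xy; split=> //; apply: contra euv.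
by case/orP=> /andP[/eqP<- /eqP<-]; rewrite // e_sym.
Qed.

Lemma C4_realizes : V = [set u; x1; x2; v] -> e u v -> realizes V e C4.
Proof.
move=> VE euv; have un := thr_uniq th; set c := [:: u; x1; x2; v] in un.
have e13 : e x1 v = false.
  apply/negP=> /(thr_nb1 th); move: un; rewrite /= !inE !negb_or.
  rewrite (eq_sym v) (eq_sym v) => /and4P[/and3P[_ _ /negbTE->] /andP[_ _] /negbTE-> _].
  by [].
have e20 : e u x2 = false.
  rewrite e_sym; apply/negP=> /(thr_nb2 th); move: un; rewrite /= !inE !negb_or.
  by case/and4P=> /and3P[/negbTE-> _ /negbTE->].
case: th => e01 e12 e23 _ _ _.
exists (fun i : 'I_4 => nth u c i); split.
- by move=> i j /eqP; rewrite nth_uniq // => /eqP/val_inj.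
- move=> i; have : nth u c i \in c by rewrite mem_nth.
  by rewrite VE !inE -!orbA.
- move=> y; rewrite VE !inE -!orbA => yc.
  have {}yc : y \in c by rewrite !inE.
  have lt4 : index y c < 4 by rewrite -index_mem in yc.
  by exists (Ordinal lt4); rewrite /= nth_index // -index_mem.
- case=> [[|[|[|[|//]]]] i] [[|[|[|[|//]]]] j]; rewrite /= ?e_irr ?e01 ?e12 ?e23 //;
    by rewrite e_sym ?e01 ?e12 ?e23 ?e13 ?e20 ?euv.
Qed.

End Realize.

(** The parity hypothesis makes the removal of vertices in pairs end with four of
    them. *)
Lemma block_realized (T : finType) (V : {set T}) (e D : rel T) (col : pred T) :
    odd_block V e D col -> 2 < #|V| -> ~~ odd #|V| ->
  exists2 H, C4_constructible H & realizes V e H.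
Proof.
have [n] := ubnP #|V|; elim: n V e D => // n IH V e D lt_n B V3 Vev.
have [u [x1 [x2 [v th]]]] := block_thread B V3.
have se := ob_sym B; have e_in := ob_in B.
have e_irr : irreflexive e.
  by move=> x; apply/negP=> /(ob_col B); rewrite eqxx.
have [uv un vn] := thread_neq th.
have x12 := thread_neq12 th.
have sub : [set u; x1; x2; v] \subset V.
  apply/subsetP=> z; rewrite !inE -!orbA => /or4P[]/eqP->.
  - exact: e_in (thr_ux th).
  - exact: e_in (thr_xx th).
  - exact: e_in (thr_xv th).
  - by apply: (e_in v x2); rewrite se (thr_xv th).
have c4 : #|[set u; x1; x2; v]| = 4.
  transitivity #|[:: u; x1; x2; v]|; last by rewrite (card_uniqP (thr_uniq th)).
  by apply: eq_card => z; rewrite !inE -!orbA.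
have [VE|/negbTE VN] := eqVneq V [set u; x1; x2; v].
  exists C4; first exact: constr_C4.
  apply: (C4_realizes se e_irr th VE).
  have uV : u \in V by exact: e_in (thr_ux th).
  have ux1 : u != x1 by move: un; rewrite !inE negb_or => /andP[].
  have [z uz zx1] := block_neighbor B V3 uV ux1.
  have : z \in V by apply: (e_in z u); rewrite se.
  rewrite VE !inE (negbTE zx1) -!orbA => /or4P[]// /eqP zE; rewrite zE ?e_irr // in uz *.
  move: uz; rewrite se => /(thr_nb2 th); rewrite (negbTE ux1) (negbTE uv).
  by [].
have lt4 : 4 < #|V|.
  by rewrite -c4; apply: proper_card; rewrite properEneq sub eq_sym VN.
have cV : #|V :\: [set x1; x2]| = #|V| - 2.
  rewrite cardsD (setIidPr _) ?cards2 ?x12 //.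
  by apply: subset_trans sub; apply/subsetP=> z; rewrite !inE => /orP[]->; rewrite ?orbT.
have [|||H cH rH] := IH _ _ _ _ (block_contract B th).
- by rewrite cV; lia.
- rewrite cV; move: Vev lt4; case: #|V| => [|[|[|[|[|[|]]]]]] //.
- by rewrite cV oddB ?(leq_trans _ lt4) //= addbF.
exact: (contract_realizes se e_irr th e_in cH rH).
Qed.

(** * Perfect matchings as involutions *)

Section PerfectMatchings.
Variable T : finType.
Implicit Types (e : rel T) (A : {set T}) (f : T -> T).

(** [f] maps every vertex of [A] to its partner in a perfect matching of the subgraph
    induced by [A]. *)
Definition mates e A f : Prop :=
  forall x, x \in A -> [/\ f x \in A, e x (f x) & f (f x) = x].

Lemma involution_even A f :
  (forall x, x \in A -> [/\ f x \in A, f x != x & f (f x) = x]) -> ~~ odd #|A|.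
Proof.
have [n] := ubnP #|A|; elim: n A => // n IH A lt_n fA.
have [->|[x xA]] := set_0Vmem A; first by rewrite cards0.
have [fxA fx ffx] := fA x xA.
have E : #|A| = #|A :\ x :\ f x|.+2.
  by rewrite (cardsD1 x A) xA (cardsD1 (f x) (A :\ x)) !inE fx fxA.
rewrite E /= negbK; apply: IH; first by move: lt_n; rewrite E; lia.
move=> z; rewrite !inE => /and3P[zfx zx zA].
have [fzA fz ffz] := fA z zA; rewrite fzA andbT; split=> //; apply/andP; split.
  by apply: contra zx => /eqP fE; rewrite -ffz fE ffx.
by apply: contra zfx => /eqP<-; rewrite ffz.
Qed.

End PerfectMatchings.

Lemma matching_mates (G : sgraph) (A : {set G}) M : perfect_matching_of A M ->
  exists2 f, mates sedge A f & forall a b, [set a; b] \in M -> f a = b.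
Proof.
case/andP=> /subsetP ME /and3P[/eqP cM tM _].
have edge_in B : B \in M -> exists a b, B = [set a; b] /\ sedge a b.
  by move/ME=> /imsetP[[a b]]; rewrite inE => ab ->; exists a, b.
pose f x := odflt x [pick y in pblock M x :\ x].
have fE a b : [set a; b] \in M -> f a = b.
  move=> abM; have [c [d [E cd]]] := edge_in _ abM.
  have ab : a != b.
    move/eqP: E; rewrite set2_eq => /orP[]/andP[/eqP-> /eqP->].
      exact: sedge_neq.
    by apply: sedge_neq; rewrite sedge_sym.
  rewrite /f (def_pblock tM abM) ?set21 //.
  case: pickP => [y|/(_ b)] /=; rewrite !inE ?eqxx ?orbT ?andbT 1?eq_sym ?ab //.
  by case/andP=> ya /predU1P[yE|/eqP->] //; rewrite yE eqxx in ya.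
exists f => // x; rewrite -cM => /bigcupP[B BM xB].
have [a [b [E ab]]] := edge_in _ BM; rewrite {B}E in BM xB.
have BM' : [set b; a] \in M by rewrite setUC.
have inA c : c \in [set a; b] -> c \in cover M by move=> cB; apply/bigcupP; exists [set a; b].
move: xB; rewrite !inE => /orP[]/eqP->.
- by rewrite (fE _ _ BM); split; rewrite ?inA ?set22 // (fE _ _ BM').
- rewrite (fE _ _ BM'); split; [by rewrite inA ?set21 | by rewrite sedge_sym | exact: fE].
Qed.

Lemma mates_matching (G : sgraph) (A : {set G}) f :
  mates sedge A f -> has_perfect_matching A.
Proof.
move=> fA; exists [set [set x; f x] | x in A]; apply/andP; split.
  apply/subsetP=> _ /imsetP[x /fA[_ xf _] ->].
  by apply/imsetP; exists (x, f x); rewrite ?inE.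
apply/and3P; split.
- rewrite eqEsubset; apply/andP; split; apply/subsetP=> x.
    by case/bigcupP=> _ /imsetP[y yA ->]; have [fy _ _] := fA y yA;
      rewrite !inE => /orP[]/eqP->.
  by move=> xA; apply/bigcupP; exists [set x; f x]; rewrite ?set21 //;
    apply/imsetP; exists x.
- apply/trivIsetP=> _ _ /imsetP[x xA ->] /imsetP[y yA ->] xy.
  have [_ _ ffx] := fA x xA; have [_ _ ffy] := fA y yA.
  rewrite -setI_eq0; apply: contraNT xy => /set0Pn[z]; rewrite !inE.
  case/andP=> /orP[]/eqP-> /orP[]/eqP E.
  + by rewrite E.
  + by rewrite E ffy setUC.
  + by rewrite -E ffx setUC.
  + by rewrite -ffx E ffy.
- apply/imsetP=> -[x _ /setP/(_ x)]; rewrite !inE eqxx.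
  by [].
Qed.

Section MatchingCovered.
Variable G : sgraph.
Hypothesis G_mc : matching_covered G.

Lemma edge_mates (a b : G) : sedge a b -> exists2 f, mates sedge [set: G] f & f a = b.
Proof.
case: G_mc => _ _ cov ab; have [|M pM abM] := cov [set a; b].
  by apply/imsetP; exists (a, b); rewrite ?inE.
by have [f fM fE] := matching_mates pM; exists f; last exact: fE.
Qed.

(** Suppose that [w] separates [x] from [y].  Both components send an edge to [w].  A
    perfect matching through the edge to the component of [x] restricts to one of
    the component [K] of [y], so [K] is even; a perfect matching through the edge
    from [K] to [w] leaves exactly one vertex of [K] unmatched inside [K], so [K] is
    odd. *)
Lemma matching_covered_two_connected (w x y : G) :
  x != w -> y != w -> connect (avoiding sedge w) x y.
Proof.
move=> xw yw; apply/negPn/negP=> nxy.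
have csym : connect_sym (avoiding (@sedge G) w).
  by apply: sym_connect_sym => a b; rewrite /avoiding sedge_sym [_ && (b != w)]andbC.
pose K z := [set t | connect (avoiding sedge w) z t].
have wK z : z != w -> w \notin K z.
  rewrite inE => zw; apply/connectP=> -[p /avoiding_path[_ wp] wE].
  by have := mem_last z p; rewrite -wE inE (negbTE wp) orbF eq_sym (negbTE zw).
have nbr z : z != w -> exists2 t, t \in K z & sedge t w.
  case: G_mc => /(_ z w)/connectP[p pp wE] _ _ zw.
  elim: p z zw pp wE => [|t p IH] z zw /=; first by move=> _ E; rewrite E eqxx in zw.
  case/andP=> zt pt wE; have [tw|tw] := eqVneq t w.
    by exists z; rewrite ?inE ?connect0 // -tw.
  have [r rK rw] := IH _ tw pt wE; exists r => //; move: rK; rewrite !inE.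
  by apply: connect_trans; apply: connect1; apply/and3P.
have closed f z : mates sedge [set: G] f -> z != w ->
    forall t, t \in K z -> t != f w -> f t \in K z.
  move=> fm zw t tK tf; have [_ tft fft] := fm t (in_setT _).
  move: (tK); rewrite !inE => zt; apply: connect_trans zt _; apply: connect1.
  apply/and3P; split=> //; first by apply: contraTneq tK => ->; apply: wK.
  by apply: contraNneq tf => <-; rewrite fft.
have [t1 t1K t1w] := nbr x xw; have [t2 t2K t2w] := nbr y yw.
have [f fm fw] : exists2 f, mates sedge [set: G] f & f w = t1.
  by apply: edge_mates; rewrite sedge_sym.
have [g gm gw] : exists2 f, mates sedge [set: G] f & f w = t2.
  by apply: edge_mates; rewrite sedge_sym.
have neq h t : mates sedge [set: G] h -> h t != t.
  by move=> hm; have [_ th _] := hm t (in_setT _); rewrite eq_sym sedge_neq.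
have ev : ~~ odd #|K y|.
  apply: (@involution_even _ _ f) => t tK; have [_ _ fft] := fm t (in_setT _).
  split=> //; last exact: neq.
  apply: closed => //; rewrite fw; apply: contraNneq nxy => tE; rewrite tE in tK.
  by move: t1K tK; rewrite !inE => xt yt; rewrite (connect_trans xt) // csym.
have : ~~ odd #|K y :\ t2|.
  apply: (@involution_even _ _ g) => t /setD1P[tt tK]; have [_ _ ggt] := gm t (in_setT _).
  split=> //; last exact: neq.
  apply/setD1P; split; last by apply: closed; rewrite ?gw.
  apply: contraTneq tK => E; have [_ _ ggw] := gm w (in_setT _).
  by rewrite -ggt E -gw ggw wK.
by move: ev; rewrite (cardsD1 t2 (K y)) t2K /= => /negPn->.
Qed.

End MatchingCovered.

(** * From cycle-conformal to constructible *)

Lemma cycle_conformal_constructible (G : sgraph) :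
    matching_covered G -> pfaffian G -> bipartite G -> cycle_conformal G ->
  exists2 H : sgraph, C4_constructible H & isomorphic H G.
Proof.
move=> G_mc [[M pM] [D [_ Ddir] Dodd]] [A col] [_ conf].
have B : odd_block [set: G] sedge D (mem A).
  split=> //.
  - exact: sedge_sym.
  - by move=> w x y _ _; apply: matching_covered_two_connected.
  - move=> x r sr ur pr; rewrite -odd_count_next //.
    have ev : even_cycle (x :: r).
      apply/andP; split; first by apply/and3P.
      by have /= := path_color (col := mem A) col pr; case: (x \in A); case: odd.
    exact: Dodd (conf _ ev).
have [f fM _] := matching_mates pM.
have [||H cH [h [h_inj _ h_on h_mono]]] := block_realized B.
- by case: G_mc => _ + _; rewrite cardsT; apply: leq_trans.
- apply: (@involution_even _ _ f) => x xT; have [? xf ?] := fM x xT.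
  by split=> //; rewrite eq_sym sedge_neq.
exists H => //; exists h => //; apply: inj_card_bij => //.
have <- : #|codom h| = #|H| by rewrite card_codom.
by apply: subset_leq_card; apply/subsetP=> y _; have [x ->] := h_on y (in_setT _);
  apply: codom_f.
Qed.

(** * From constructible to cycle-conformal *)

Section Matched.
Variable T : finType.
Implicit Types (e : rel T) (A V : {set T}) (f : T -> T).

(** Besides conformality of even cycles, the invariant has to say that every edge
    lies in a perfect matching: the cycle formed by an edge and a new parallel path
    of length 3 is conformal only then.  The degree condition supplies a perfect
    matching that avoids a given edge, as the middle edge of a new path needs. *)
Record well_matched V e : Prop := WellMatched {
  wm_sym : symmetric e;
  wm_irr : irreflexive e;
  wm_in : forall x y, e x y -> x \in V;
  wm_deg : forall x y, x \in V -> exists2 z, e x z & z != y;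
  wm_pm : exists f, mates e V f;
  wm_edge : forall x y, e x y -> exists2 f, mates e V f & f x = y;
  wm_cycle : forall c, 2 < size c -> ucycle e c -> ~~ odd (size c) ->
    exists f, mates e (V :\: [set z in c]) f }.

Lemma mates_sub e e' A f :
  (forall x, x \in A -> e x (f x) -> e' x (f x)) -> mates e A f -> mates e' A f.
Proof. by move=> ee' fA x xA; have [? ? ?] := fA x xA; split=> //; apply: ee'. Qed.

Lemma well_matched_eq V V' e e' : V = V' -> e =2 e' ->
  well_matched V e -> well_matched V' e'.
Proof.
move=> <- ee [s i m d [f0 pm] ed cy].
have mm A f : mates e A f -> mates e' A f by apply: mates_sub => x _; rewrite ee.
split.
- by move=> x y; rewrite -!ee s.
- by move=> x; rewrite -ee i.
- by move=> x y; rewrite -ee => /m.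
- by move=> x y /d-/(_ y)[z xz zy]; exists z; rewrite // -ee.
- by exists f0; apply: mm.
- by move=> x y; rewrite -ee => /ed[f fm fx]; exists f => //; apply: mm.
- move=> c c2 /andP[cc uc] co; have [|f fm] := cy c c2 _ co.
    by rewrite /ucycle uc andbT (eq_cycle ee).
  by exists f; apply: mm.
Qed.

Section ThreadStep.
Variables (V : {set T}) (e : rel T) (u x1 x2 v : T).
Hypotheses (e_sym : symmetric e) (e_irr : irreflexive e).
Hypotheses (e_in : forall x y, e x y -> x \in V) (th : thread e u x1 x2 v).

Let e' := contract e u x1 x2 v.
Let W := V :\: [set x1; x2].

Lemma thread_in : [/\ u \in V, x1 \in V, x2 \in V & v \in V].
Proof.
split; first exact: e_in (thr_ux th); first exact: e_in (thr_xx th).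
  exact: e_in (thr_xv th).
by apply: (e_in (y := x2)); rewrite e_sym (thr_xv th).
Qed.

Lemma in_W z : (z \in W) = (z \notin [:: x1; x2]) && (z \in V).
Proof. by rewrite !inE. Qed.

Lemma mates_contract A f : A \subset W -> ~~ ((u \in A) && (f u == v)) ->
  mates e' A f -> mates e A f.
Proof.
move=> AW nuv fA; apply: mates_sub (fA) => x xA.
have [fxA _ ffx] := fA x xA.
rewrite /e' /contract => /or3P[/and3P[] //|/andP[/eqP xu /eqP fv]|/andP[/eqP xv /eqP fu]].
  by rewrite -xu xA fv eqxx in nuv.
by rewrite -fu ffx fxA xv eqxx in nuv.
Qed.

(** A matching that does not use the contracted edge is extended by the edge
    [x1 x2]. *)
Lemma mates_pair A f : A \subset W -> mates e A f ->
  exists2 g, mates e (A :|: [set x1; x2]) g & g x1 = x2 /\ {in A, g =1 f}.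
Proof.
move=> AW fA; have x12 := thread_neq12 th.
have An x : x \in A -> (x == x1 = false) * (x == x2 = false).
  by move/(subsetP AW); rewrite in_W !inE negb_or => /andP[/andP[/negbTE-> /negbTE->]].
exists (fun x => if x == x1 then x2 else if x == x2 then x1 else f x); last first.
  by rewrite eqxx; split=> // x /An E; rewrite !E.
move=> x; rewrite !inE orbC => /orP[/orP[]/eqP->|xA].
- by rewrite eqxx eq_sym (negbTE x12) !eqxx !orbT (thr_xx th).
- by rewrite eqxx eq_sym (negbTE x12) !eqxx !orbT e_sym (thr_xx th).
- by have [fxA xf ffx] := fA x xA; rewrite !(An _ xA) !(An _ fxA) fxA.
Qed.

(** A matching that uses the contracted edge [u v] is changed to use [u x1] and
    [x2 v] instead. *)
Lemma mates_expand A f : A \subset W -> u \in A -> f u = v -> mates e' A f ->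
  exists2 g, mates e (A :|: [set x1; x2]) g &
    [/\ g x1 = u, g x2 = v, g u = x1, g v = x2 &
        {in A, forall x, x != u -> x != v -> g x = f x}].
Proof.
move=> AW uA fu fA; have x12 := thread_neq12 th; have [uv _ _] := thread_neq th.
have [vA _ fv] := fA u uA; rewrite fu in vA fv.
have An x : x \in A -> (x == x1 = false) * (x == x2 = false).
  by move/(subsetP AW); rewrite in_W !inE negb_or => /andP[/andP[/negbTE-> /negbTE->]].
have vu : (v == u) = false by rewrite eq_sym (negbTE uv).
have x21 : (x2 == x1) = false by rewrite eq_sym (negbTE x12).
pose g x := if x == x1 then u else if x == x2 then v else
  if x == u then x1 else if x == v then x2 else f x.
have [g1 g2 gu gv] : [/\ g x1 = u, g x2 = v, g u = x1 & g v = x2].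
  by rewrite /g !eqxx x21 !(An _ uA) !(An _ vA) vu.
have gE x : x \in A -> x != u -> x != v -> g x = f x.
  by move=> xA /negbTE xu /negbTE xv; rewrite /g !(An _ xA) xu xv.
exists g => // x; rewrite !inE orbC => /orP[/orP[]/eqP->|xA].
- by rewrite g1 gu uA e_sym (thr_ux th).
- by rewrite g2 gv vA (thr_xv th).
have [->|xu] := eqVneq x u; first by rewrite gu g1 eqxx orbT (thr_ux th).
have [->|xv] := eqVneq x v; first by rewrite gv g2 eqxx !orbT e_sym (thr_xv th).
have [fxA xf ffx] := fA x xA; have [fxu fxv] : f x != u /\ f x != v.
  split; first by apply: contraNneq xv => E; rewrite -ffx E fu.
  by apply: contraNneq xu => E; rewrite -ffx E fv.
rewrite gE // gE // fxA ffx; split=> //.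
by move: xf; rewrite /e' /contract (negbTE xu) (negbTE xv) orbF => /and3P[].
Qed.

Hypothesis wm : well_matched W e'.

(** The edges [u x1] and [x2 v] come from a matching through [u v], the edge [x1 x2]
    from one that matches [u] differently.  The delicate case is an edge matched
    together with [u v]: if [u v] is an edge of [e], it is kept. *)
Lemma thread_edge y z : e y z -> exists2 f, mates e V f & f y = z.
Proof.
have [uV x1V x2V vV] := thread_in; have [uv un vn] := thread_neq th.
have uW : u \in W by rewrite in_W un.
have vW : v \in W by rewrite in_W vn.
have WE : W :|: [set x1; x2] = V.
  by rewrite setUC -{1}(setIidPr (_ : [set x1; x2] \subset V)) ?setID //;
    apply/subsetP=> t; rewrite !inE => /orP[]/eqP->.
have uv' : e' u v by rewrite /e' /contract !eqxx orbT.
have [f fm fu] := wm_edge wm uv'.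
have [g gm [g1 g2 gu gv _]] := mates_expand (subxx W) uW fu fm; rewrite WE in gm.
have [w uw wv] := wm_deg wm v uW; have [h hm hu] := wm_edge wm uw.
have [|k km [k1 _]] := mates_pair (subxx W) (mates_contract (subxx W) _ hm).
  by rewrite hu (negbTE wv) andbF.
rewrite WE in km => {f fm fu h hm hu w uw wv}.
have k2 : k x2 = x1 by have [_ _ <-] := km x1 x1V; rewrite k1.
move=> yz; have [|yn] := boolP (y \in [:: x1; x2]).
  rewrite !inE => /orP[]/eqP yE; rewrite yE in yz *.
    by case/(thr_nb1 th)/orP: yz => /eqP->; [exists g | exists k].
  by case/(thr_nb2 th)/orP: yz => /eqP->; [exists k | exists g].
have [|zn] := boolP (z \in [:: x1; x2]).
  rewrite e_sym in yz; rewrite !inE => /orP[]/eqP zE; rewrite zE in yz *.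
    by case/(thr_nb1 th)/orP: yz => /eqP->; [exists g | exists k].
  by case/(thr_nb2 th)/orP: yz => /eqP->; [exists k | exists g].
have yW : y \in W by rewrite in_W yn (e_in yz).
have yz' : e' y z by rewrite /e' /contract yz yn zn.
have [f fm fy] := wm_edge wm yz'.
have pair : mates e W f -> exists2 f, mates e V f & f y = z.
  move=> fme; have [l lm [_ lf]] := mates_pair (subxx W) fme.
  by rewrite WE in lm; exists l => //; rewrite lf.
have [euv|euv] := boolP (e u v).
  apply: pair; apply: mates_sub fm => x _.
  move=> /or3P[/and3P[]//|/andP[/eqP-> /eqP->]|/andP[/eqP-> /eqP->]] //.
  by rewrite e_sym.
have [fu|fu] := eqVneq (f u) v; last first.
  by apply: pair; apply: mates_contract fm => //; rewrite (negbTE fu) andbF.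
have [l lm [_ _ _ _ lf]] := mates_expand (subxx W) uW fu fm.
rewrite WE in lm; exists l; rewrite ?lf //.
  by apply: contraNneq euv => yu; rewrite -fu -yu fy.
have [_ _ fv] := fm u uW; rewrite fu in fv.
by apply: contraNneq euv => yv; rewrite e_sym -fv -yv fy.
Qed.

Lemma thread_deg x y : x \in V -> exists2 z, e x z & z != y.
Proof.
have [uV x1V x2V vV] := thread_in; have [uv un vn] := thread_neq th.
have two p q : p != q -> e x p -> e x q -> exists2 z, e x z & z != y.
  by move=> pq xp xq; have [py|] := eqVneq p y; [exists q; rewrite // -py eq_sym | exists p].
have ux2 : u != x2 by move: un; rewrite !inE negb_or => /andP[].
have vx1 : v != x1 by move: vn; rewrite !inE negb_or => /andP[].
move=> xV; have [|xn] := boolP (x \in [:: x1; x2]).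
  rewrite !inE => /orP[]/eqP xE; rewrite xE in two *.
    by apply: two ux2 _ (thr_xx th); rewrite e_sym (thr_ux th).
  by apply: two vx1 (thr_xv th) _; rewrite e_sym (thr_xx th).
have xW : x \in W by rewrite in_W xn.
have off z : e' x z -> ~~ ((x == u) && (z == v)) -> ~~ ((x == v) && (z == u)) ->
    e x z /\ z \notin [:: x1; x2].
  by rewrite /e' /contract => + /negbTE n1 /negbTE n2; rewrite n1 n2 /= orbF => /and3P[].
have [xu|xu] := eqVneq x u.
  have [z xz zv] := wm_deg wm v xW; have [||xz' zn] := off _ xz.
  - by rewrite (negbTE zv) andbF.
  - by rewrite xu (negbTE uv).
  apply: (two z x1) => //; last by rewrite xu (thr_ux th).
  by move: zn; rewrite !inE negb_or => /andP[].
have [xv|xv] := eqVneq x v.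
  have [z xz zu] := wm_deg wm u xW; have [||xz' zn] := off _ xz.
  - by rewrite (negbTE xu).
  - by rewrite (negbTE zu) andbF.
  apply: (two z x2) => //; last by rewrite xv e_sym (thr_xv th).
  by move: zn; rewrite !inE negb_or => /andP[].
have [z xz zy] := wm_deg wm y xW; exists z => //.
by have [||] := off _ xz; rewrite ?(negbTE xu) ?(negbTE xv).
Qed.

Lemma thread_cycle_off c : 2 < size c -> ucycle e c -> ~~ odd (size c) ->
    x1 \notin c -> x2 \notin c -> exists f, mates e (V :\: [set z in c]) f.
Proof.
move=> c2 /andP[cc uc] co c1n c2n; have [_ x1V x2V _] := thread_in.
have off z : z \in c -> z \notin [:: x1; x2].
  by move=> zc; rewrite !inE negb_or; apply/andP; split;
    [apply: contraNneq c1n => <- | apply: contraNneq c2n => <-].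
have cc' : cycle e' c.
  apply: (sub_in_cycle (P := mem c)) cc; last exact/allP.
  by move=> x y xc yc xy; rewrite /e' /contract xy !off.
have [f fm] := wm_cycle wm c2 (introT andP (conj cc' uc)) co.
have -> : V :\: [set z in c] = (W :\: [set z in c]) :|: [set x1; x2].
  apply/setP=> z; rewrite !inE; case: (eqVneq z x1) => [->|_]; first by rewrite c1n x1V orbT.
  by case: (eqVneq z x2) => [->|_] /=; [rewrite c2n x2V !orbT | rewrite orbF].
have AW : W :\: [set z in c] \subset W by apply: subsetDl.
have [/andP[uA /eqP fu]|nuv] := boolP ((u \in W :\: [set z in c]) && (f u == v)).
  by have [g gm _] := mates_expand AW uA fu fm; exists g.
by have [g gm _] := mates_pair AW (mates_contract AW nuv fm); exists g.
Qed.

(** Such a cycle runs through [u], [x1], [x2], [v].  Contracting gives a cycle with the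
    same complement, unless only [u] and [v] remain; then a perfect matching through
    [u v] is used. *)
Lemma thread_cycle_x1 c : 2 < size c -> ucycle e c -> ~~ odd (size c) ->
  x1 \in c -> exists f, mates e (V :\: [set z in c]) f.
Proof.
move=> c2 /andP[cc uc] co x1c; have [uv un vn] := thread_neq th.
have {uc cc x1c}[r [ur pr sr rE hr]] : exists r, [/\ uniq (x1 :: r), path e x1 (rcons r x1),
    size c = (size r).+1, x1 :: r =i c & head x1 r = x2].
  have [i r rotE] := rot_to x1c.
  have rc : x1 :: r =i c by move=> z; rewrite -rotE mem_rot.
  have sr : size c = (size r).+1 by rewrite -(size_rot i c) rotE.
  have ur : uniq (x1 :: r) by rewrite -rotE rot_uniq.
  have pr : path e x1 (rcons r x1) by move: cc; rewrite -(rot_cycle i) rotE.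
  have [hx|hx] := eqVneq (head x1 r) x2; first by exists r.
  exists (rev r); split.
  - by move: ur; rewrite /= mem_rev rev_uniq.
  - by rewrite -path_reverse.
  - by rewrite size_rev.
  - by move=> z; rewrite !inE mem_rev -rc inE.
  case/lastP: r {rotE rc} => [|[|y r] l] in sr ur pr hx *; try by rewrite sr in c2.
  rewrite rev_rcons /=; move: pr; rewrite rcons_path last_rcons /= => /andP[/andP[xy _]].
  rewrite e_sym => /(thr_nb1 th)/orP[]/eqP // lu.
  move: xy => /(thr_nb1 th); rewrite (negbTE hx) orbF => /eqP yu.
  by move: ur; rewrite /= mem_rcons yu lu inE eqxx andbF.
case: r => [|y r] in ur pr sr rE hr *; first by move: c2; rewrite sr.
move: hr => /= yE; rewrite {y}yE in ur pr sr rE.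
case: r => [|y r] in ur pr sr rE *; first by move: c2; rewrite sr.
have yv : y = v.
  move: pr ur => /= /and3P[_ x2y _]; case/(thr_nb2 th)/orP: x2y => /eqP-> //.
  by rewrite !inE eqxx orbT.
rewrite {y}yv in ur pr sr rE.
have lu : last v r = u.
  move: pr ur => /=; rewrite rcons_path => /and4P[_ _ _ lx1] /and3P[_ x2n _].
  rewrite e_sym in lx1; case/(thr_nb1 th)/orP: lx1 => /eqP // lx2.
  by rewrite -lx2 mem_last in x2n.
have off z : z \in v :: r -> z \notin [:: x1; x2].
  move=> zr; move: ur; rewrite 2!cons_uniq inE negb_or => /and3P[/andP[_ x1n] x2n _].
  rewrite !inE negb_or; apply/andP; split; first by apply: contraTneq zr => ->.
  by apply: contraTneq zr => ->.
have pe : path e' v (rcons r v).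
  rewrite rcons_path lu /e' /contract !eqxx /= orbT andbT.
  move: pr => /= /and3P[_ _]; rewrite rcons_path => /andP[pr _].
  apply: (sub_in_path (P := mem (v :: r))) pr; last exact/allP.
  by move=> x y xr yr xy; rewrite xy !off.
have uvr : uniq (v :: r) by case/and3P: ur.
have CE : V :\: [set z in c] = W :\: [set z in v :: r].
  by apply/setP=> z; rewrite !inE -rE !inE !negb_or -!andbA; do !bool_congr.
have AW : W :\: [set z in v :: r] \subset W by apply: subsetDl.
have nu f : ~~ ((u \in W :\: [set z in v :: r]) && (f u == v)).
  by rewrite in_setD inE -{1}lu mem_last.
rewrite CE; have [r2|r2] := ltnP 1 (size r).
  have [|f fm] := wm_cycle wm (c := v :: r) r2 (introT andP (conj pe uvr)).
    by move: co; rewrite sr /= !negbK.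
  by exists f; apply: mates_contract.
have rE1 : r = [:: u].
  case: (r) lu r2 => [|y [|]] //=; last by move=> ->.
  by move=> vu; rewrite vu eqxx in uv.
have [f fm fu] : exists2 f, mates e' W f & f u = v.
  by apply: (wm_edge wm); rewrite /e' /contract !eqxx orbT.
exists f; apply: mates_contract => // z; rewrite rE1 !inE !negb_or.
case/and3P=> /andP[zv zu] zx zV; have zW : z \in W by rewrite !inE negb_or zx.
have [fzW zf ffz] := fm z zW; have uW : u \in W by rewrite in_W un; case: thread_in.
have [_ _ fv] := fm u uW; rewrite fu in fv.
split=> //; move: fzW; rewrite in_W !inE negb_or => -> ; rewrite andbT; apply/andP; split.
  by apply: contraNneq zu => E; rewrite -ffz E fv.
by apply: contraNneq zv => E; rewrite -ffz E fu.
Qed.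

End ThreadStep.

Lemma well_matched_thread V e u x1 x2 v : symmetric e -> irreflexive e ->
    (forall x y, e x y -> x \in V) -> thread e u x1 x2 v ->
    well_matched (V :\: [set x1; x2]) (contract e u x1 x2 v) ->
  well_matched V e.
Proof.
move=> se ie ein th wm.
have edge := thread_edge se ein th wm.
split=> //.
- exact: thread_deg wm.
- by have [f fm _] := edge _ _ (thr_ux th); exists f.
move=> c c2 cc co.
have [x1c|x1n] := boolP (x1 \in c); first exact: thread_cycle_x1 wm _ c2 cc co x1c.
have [x2c|x2n] := boolP (x2 \in c); last exact: thread_cycle_off wm _ c2 cc co x1n x2n.
have wm' : well_matched (V :\: [set x2; x1]) (contract e v x2 x1 u).
  apply: well_matched_eq wm; first by rewrite setUC.
  by move=> x y; rewrite contractC.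
exact: thread_cycle_x1 (thread_sym se th) wm' _ c2 cc co x2c.
Qed.

Lemma path_edge_mem (s : seq T) x y : path_edge s x y -> (x \in s) && (y \in s).
Proof. by rewrite /path_edge => /orP[]/mem_infix H; rewrite !H ?inE ?eqxx ?orbT. Qed.

(** Two interior vertices at a time, a path with an even number of interior vertices
    is contracted to the edge [u v].  The graph [e] may contain [u v]
    (3-path operation) or not (bisubdivision). *)
Lemma well_matched_path V e u v s :
    symmetric e -> irreflexive e -> (forall x y, e x y -> x \in V) ->
    u \in V -> v \in V -> u != v -> uniq s -> {in s, forall x, x \notin V} ->
    ~~ odd (size s) ->
    well_matched V (fun x y => e x y || path_edge [:: u; v] x y) ->
  well_matched (V :|: [set x in s]) (fun x y => e x y || path_edge (u :: rcons s v) x y).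
Proof.
move=> se ie ein uV vV uv; have [n] := ubnP (size s).
elim: n s => // n IH [|x1 [|x2 s]] //= lt_n us sV os wm.
  by apply: well_matched_eq wm => // ; apply/setP=> z; rewrite !inE orbF.
have {}IH := IH s.
have un : uniq [:: u, x1, x2 & rcons s v].
  have nV z : z \in V -> z \notin [:: x1, x2 & s] by apply: contraL => /sV.
  rewrite -[u :: _]/(u :: rcons [:: x1, x2 & s] v) cons_uniq rcons_uniq mem_rcons inE.
  by rewrite negb_or uv !nV.
set h := head v s; have sE : rcons s v = h :: behead (rcons s v) by rewrite /h; case: (s).
pose R x y := e x y || path_edge [:: u, x1, x2 & rcons s v] x y.
have RE x y : R x y = [|| e x y, (x == u) && (y == x1), (x == x1) && (y == u),
    (x == x1) && (y == x2), (x == x2) && (y == x1), (x == x2) && (y == h),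
    (x == h) && (y == x2) | path_edge (rcons s v) x y].
  by rewrite /R sE !path_edge_cons.
have x1V : x1 \notin V by apply: sV; rewrite inE eqxx.
have x2V : x2 \notin V by apply: sV; rewrite !inE eqxx orbT.
have offV x y : e x y -> [/\ x != x1, y != x1, x != x2 & y != x2].
  move=> xy; have xV := ein _ _ xy; have yV : y \in V by rewrite se in xy; apply: ein xy.
  by split; [apply: contraNneq x1V|apply: contraNneq x1V|
    apply: contraNneq x2V|apply: contraNneq x2V] => <-.
have pathV x y : path_edge (rcons s v) x y ->
    [/\ x != x1, y != x1, x != x2 & y != x2].
  have x1n : x1 \notin rcons s v by move: un; rewrite /= !inE !negb_or => /and3P[_ /andP[]].
  have x2n : x2 \notin rcons s v by move: un; rewrite /= !inE !negb_or => /and4P[].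
  by case/path_edge_mem/andP=> xs ys; split;
    [apply: contraNneq x1n|apply: contraNneq x1n|
     apply: contraNneq x2n|apply: contraNneq x2n] => <-.
have hs : h \in rcons s v by rewrite sE mem_head.
have u4 : uniq [:: u; x1; x2; h].
  move: un; rewrite /= !inE !negb_or => /and4P[/and3P[-> -> nu] /andP[-> n1] n2 _].
  by rewrite !andbT; apply/and3P; split;
    [apply: contraNneq nu|apply: contraNneq n1|apply: contraNneq n2] => ->.
have [n1 n2 n3] : [/\ [/\ x1 == u = false, x1 == x2 = false & x1 == h = false],
    [/\ x2 == u = false, x2 == x1 = false & x2 == h = false] & h == u = false].
  move: u4; rewrite /= !inE !negb_or => /and4P[/and3P[a1 a2 a3] /andP[a4 a5] a6 _].
  by split; [split|split|]; apply/negbTE; rewrite // eq_sym.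
case: n1 n2 => n1u n12 n1h [n2u n21 n2h].
have th : thread R u x1 x2 h.
  split=> //.
  - by rewrite RE !eqxx !orbT.
  - by rewrite RE !eqxx !orbT.
  - by rewrite RE !eqxx !orbT.
  - move=> y; rewrite RE eqxx n1u n12 n1h /= => /or4P[|->|->|] //; rewrite ?orbT //.
      by move/offV => [/eqP].
    by move/pathV => [/eqP].
  - move=> y; rewrite RE eqxx n2u n21 n2h /= => /or4P[|->|->|] //; rewrite ?orbT //.
      by move/offV => [_ _ /eqP].
    by move/pathV => [_ _ /eqP].
have RV x y : R x y -> x \in V :|: [set z in [:: x1, x2 & s]].
  case/orP=> [/ein|/path_edge_mem/andP[xs _]]; first by rewrite inE => ->.
  move: xs; rewrite !inE mem_rcons !inE => /or4P[/eqP->|->|->|/orP[/eqP->|->]];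
    by rewrite ?uV ?vV ?orbT.
apply: (well_matched_thread (u := u) (x1 := x1) (x2 := x2) (v := h)) RV th _.
- by move=> x y; rewrite /R se path_edge_sym.
- by move=> x; rewrite /R ie path_edge_irrefl.
have [lt_s us' sV' os'] : [/\ size s < n, uniq s, {in s, forall x, x \notin V}
    & ~~ odd (size s)].
  split; [exact: ltnW lt_n | by case/and3P: us | | by rewrite negbK in os].
  by move=> z zs; apply: sV; rewrite !inE zs !orbT.
apply: well_matched_eq (IH lt_s us' sV' os' wm).
- have [/negbTE x1s /negbTE x2s] : x1 \notin s /\ x2 \notin s.
    by move: us; rewrite inE negb_or => /and3P[/andP[_ ->] ->].
  apply/setP=> z; rewrite !inE negb_or.
  have [->|_] := eqVneq z x1; first by rewrite (negbTE x1V) x1s.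
  by have [->|_] := eqVneq z x2; first by rewrite (negbTE x2V) x2s.
- move=> x y; rewrite sE path_edge_cons -sE /contract RE !inE !negb_or.
  have [xy|_] := boolP (e x y).
    by have [-> -> -> ->] := offV _ _ xy.
  have [xy|_] := boolP (path_edge (rcons s v) x y).
    by have [-> -> -> ->] := pathV _ _ xy; rewrite /= !orbT.
  by case: (x == x1); case: (x == x2); case: (y == x1); case: (y == x2);
    rewrite /= ?andbF ?andbT ?orbF.
Qed.
End Matched.

Lemma well_matched_image (T T' : finType) (f : T -> T') (e : rel T) (e' : rel T') :
    injective f -> {mono f : x y / e x y >-> e' x y} ->
    (forall x y, e' x y -> exists a b, x = f a /\ y = f b) ->
  well_matched [set: T] e -> well_matched [set y in codom f] e'.
Proof.
move=> f_inj f_mono e'f [s i m d [f0 pm] ed cy].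
have transport (A : {set T}) (A' : {set T'}) h : A' = f @: A -> mates e A h ->
    exists2 h', mates e' A' h' & forall x, h' (f x) = f (h x).
  move=> -> hA; pose h' y := if [pick x | f x == y] is Some x then f (h x) else y.
  have h'E x : h' (f x) = f (h x).
    by rewrite /h'; case: pickP => [z /eqP/f_inj-> //|/(_ x)]; rewrite eqxx.
  exists h' => // _ /imsetP[x xA ->]; have [hx xh hh] := hA x xA.
  by rewrite !h'E f_mono hh imset_f.
have codomE : [set y in codom f] = f @: [set: T].
  by apply/setP=> y; rewrite inE; apply/codomP/imsetP => [[x ->]|[x _ ->]]; exists x.
split.
- move=> x y; apply/idP/idP => xy; have [a [b [xE yE]]] := e'f _ _ xy.
    by rewrite xE yE in xy *; rewrite f_mono s -f_mono.
  by rewrite xE yE in xy *; rewrite f_mono s -f_mono.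
- by move=> x; apply/negP=> xx; have [a [b [xE _]]] := e'f _ _ xx; rewrite xE f_mono i in xx.
- by move=> x y /e'f[a [b [-> _]]]; rewrite inE codom_f.
- move=> x y; rewrite inE => /codomP[a ->].
  have [c ac] : exists c, e a c by have [c ac _] := d a a (in_setT _); exists c.
  have [yc|] := eqVneq y (f c); last by exists (f c); rewrite ?f_mono // eq_sym.
  have [b ab bc] := d a c (in_setT _); exists (f b); rewrite ?f_mono //.
  by rewrite yc (inj_eq f_inj).
- by have [h hm _] := transport _ _ _ codomE pm; exists h.
- move=> x y xy; have [a [b [xE yE]]] := e'f _ _ xy; rewrite {}xE {}yE f_mono in xy *.
  have [h0 hm h0a] := ed _ _ xy; have [h h'm hE] := transport _ _ _ codomE hm.
  by exists h; rewrite // hE h0a.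
- move=> c c2 /andP[cc uc] co.
  have [c0 cE] : exists c0, c = map f c0.
    have : all (mem (codom f)) c.
      apply/allP=> y yc; have := next_cycle cc yc => /e'f[a [b [-> _]]].
      exact: codom_f.
    elim: (c) => [|y c' IH] /=; first by exists [::].
    by case/andP=> /codomP[x ->] /IH[c0 ->]; exists (x :: c0).
  rewrite {}cE size_map (map_inj_uniq f_inj) in c2 cc uc co *.
  have [|h0 hm] := cy c0 c2 _ co.
    rewrite /ucycle uc andbT; case: (c0) cc => //= x p.
    by rewrite -map_rcons (path_map) (eq_path (e' := e)) // => a b; rewrite /= f_mono.
  have [|h h'm _] := transport _ ([set y in codom f] :\: [set z in map f c0]) _ _ hm;
    last by exists h.
  rewrite codomE; apply/setP=> y; rewrite !inE; apply/andP/imsetP.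
    case=> yc /imsetP[x _ yE]; exists x => //; rewrite !inE andbT.
    by apply: contra yc => xc; rewrite yE map_f.
  case=> x; rewrite !inE andbT => xc ->; rewrite (mem_map f_inj) xc.
  by rewrite imset_f.
Qed.

Lemma C4_well_matched : well_matched [set: C4] sedge.
Proof.
pose f1 (i : 'I_4) : 'I_4 := if odd i then ord_pred i else ordS i.
pose f2 (i : 'I_4) : 'I_4 := if odd i then ordS i else ord_pred i.
have m1 : mates (@sedge C4) [set: C4] f1.
  by case=> [[|[|[|[|//]]]] i] _; split; rewrite ?inE //; apply: val_inj.
have m2 : mates (@sedge C4) [set: C4] f2.
  by case=> [[|[|[|[|//]]]] i] _; split; rewrite ?inE //; apply: val_inj.
split.
- exact: C4_sym.
- exact: C4_irrefl.
- by move=> x y _; rewrite inE.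
- move=> x y _; have [yx|] := eqVneq y (ordS x); last first.
    by exists (ordS x); rewrite 1?eq_sym //= /C4_rel eqxx.
  exists (ord_pred x); first by rewrite /= /C4_rel ord_predK eqxx orbT.
  by rewrite yx; case: x {yx} => [[|[|[|[|//]]]] i].
- by exists f1.
- case=> [[|[|[|[|//]]]] i] [[|[|[|[|//]]]] j] //= _;
    by [exists f1; last exact: val_inj | exists f2; last exact: val_inj].
- move=> c c2 /andP[_ uc] co; exists id => x.
  have c4 : size c = 4.
    have := max_card (mem c); rewrite (card_uniqP uc) card_ord.
    by case: (size c) c2 co => [|[|[|[|[|]]]]].
  have /eqP cT : [set z in c] == [set: C4].
    by rewrite eqEcard subsetT cardsT card_ord cardsE (card_uniqP uc) c4.
  by rewrite cT setDv inE.
Qed.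

Lemma ear_well_matched (H : sgraph) (u v : H) n (e0 : rel (H + 'I_n)) :
    sedge u v -> ~~ odd n -> symmetric e0 -> subrel e0 (@old_edge H n) ->
    (forall a b : H, e0 (inl a) (inl b) || path_edge [:: u; v] a b = sedge a b) ->
    well_matched [set: H] sedge ->
  well_matched [set: H + 'I_n] (fun x y => e0 x y || path_edge (new_path u v n) x y).
Proof.
move=> uv ev se0 sub e0E wm.
have inl_inj : injective (@inl H 'I_n) by move=> a b [].
have V0E (x : H + 'I_n) :
    x \in [set y in codom (@inl H 'I_n)] = if x is inl _ then true else false.
  case: x => [a|i]; rewrite inE; first exact: codom_f.
  by apply/negbTE/codomP=> -[].
pose s := [seq (inr i : H + 'I_n) | i <- enum 'I_n].
have := @well_matched_path _ [set y in codom (@inl H 'I_n)] e0 (inl u) (inl v) s se0.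
have sT : [set y in codom (@inl H 'I_n)] :|: [set x in s] = [set: H + 'I_n].
  apply/setP=> x; rewrite in_setU V0E !inE; case: x => //= i.
  by apply: map_f; rewrite mem_enum.
rewrite sT; apply.
- by move=> x; apply/negP=> /sub; rewrite old_edge_irrefl.
- by move=> x y /sub; rewrite V0E; case: x.
- by rewrite V0E.
- by rewrite V0E.
- by rewrite (inj_eq inl_inj) sedge_neq.
- by rewrite map_inj_uniq ?enum_uniq // => i j [].
- by move=> _ /mapP[i _ ->]; rewrite V0E.
- by rewrite size_map size_enum_ord.
apply: (well_matched_image (e := @sedge H)) wm => //.
move=> x y; rewrite path_edge_cons path_edge1 orbF => /orP[/sub|/orP[]/andP[/eqP-> /eqP->]].
- by case: x => // a; case: y => // b _; exists a, b.
- by exists u, v.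
- by exists v, u.
Qed.

Lemma constructible_well_matched H : C4_constructible H -> well_matched [set: H] sedge.
Proof.
elim=> {H} [|H u v k uv _ IH|H u v uv _ IH].
- exact: C4_well_matched.
- apply: (ear_well_matched uv _ _ _ _ IH).
  + by rewrite odd_double.
  + by move=> x y; rewrite old_edge_sym [[set x; y]]setUC.
  + by move=> x y /andP[].
  move=> a b; rewrite set2_eq path_edge_cons path_edge1 orbF.
  have E c d : (@inl H 'I_k.*2 c == inl d) = (c == d) by [].
  rewrite !E /=; case: (boolP ((a == u) && (b == v) || (a == v) && (b == u))) => [ab|_].
    by rewrite andbF; case/orP: ab => /andP[/eqP-> /eqP->]; rewrite // sedge_sym.
  by rewrite andbT orbF.
- apply: (ear_well_matched uv _ _ _ _ IH) => //.
  + exact: old_edge_sym.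
  move=> a b; rewrite path_edge_cons path_edge1 orbF /=.
  have [//|ab] := boolP (sedge a b); apply: contraNF ab => /=.
  by case/orP => /andP[/eqP-> /eqP->]; rewrite // sedge_sym.
Qed.

Lemma constructible_cycle_conformal (G H : sgraph) :
  C4_constructible H -> isomorphic H G -> cycle_conformal G.
Proof.
move=> cH [f [g fK gK] f_mono].
have fT : [set y in codom f] = [set: G].
  by apply/setP=> y; rewrite !inE -[y]gK codom_f.
have : well_matched [set y in codom f] sedge.
  apply: well_matched_image (constructible_well_matched cH) => //.
    exact: can_inj fK.
  by move=> x y _; exists (g x), (g y); rewrite !gK.
rewrite fT => -[_ _ _ _ [h hm] _ cyc]; split; first exact: mates_matching hm.
move=> c /andP[/andP[c2 cc] co]; have [h' hm'] := cyc c c2 cc co.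
by apply: (@mates_matching _ _ h'); rewrite -setTD.
Qed.

Theorem corollary4p7 (G : sgraph) (G_mc : matching_covered G)
    (G_pfaffian : pfaffian G) (G_bip : bipartite G) :
  cycle_conformal G <->
  exists2 H : sgraph, C4_constructible H & isomorphic H G.
Proof.
split; first exact: cycle_conformal_constructible.
by case=> H; apply: constructible_cycle_conformal.
Qed.
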